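(* Let $(u_n)_{n\in\mathbb{N}}$ be a sequence in $\mathcal{X}^1$ such that $[p](u_n)\to\frac{\pi}{2}$ in $\mathbb{R}/\pi\mathbb{Z}$ and $E(u_n)\to\mathfrak{E}_{\min}(\frac{\pi}{2})$ as $n\to+\infty$. Then there exist a subsequence $(u_{\sigma(n)})$, a sequence of real numbers $(a_n)$ and a real number $\theta$ such that, as $n\to+\infty$: $u_{\sigma(n)}(\cdot+a_{\sigma(n)})\to e^{i\theta}\mathfrak{v}_0$ uniformly on every compact subset of $\mathbb{R}$; $1-|u_{\sigma(n)}(\cdot+a_{\sigma(n)})|^2\to 1-|\mathfrak{v}_0|^2$ in $L^2(\mathbb{R})$; and $u_{\sigma(n)}'(\cdot+a_{\sigma(n)})\to e^{i\theta}\mathfrak{v}_0'$ in $L^2(\mathbb{R})$.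
   Context: $\mathcal{X}^1=\{w\in L^\infty(\mathbb{R};\mathbb{C}):\ w'\in L^2,\ 1-|w|^2\in L^2\}$. Energy: $E(v)=\frac12\int_\mathbb{R}|v'|^2+\frac14\int_\mathbb{R}(1-|v|^2)^2$. Notation $\langle a,b\rangle=\mathrm{Re}(a\bar b)$. Every $v\in\mathcal{X}^1$ satisfies $|v(x)|\to1$ as $|x|\to\infty$, so $v(\pm R)\neq0$ for $R$ large and $\arg v(\pm R)\in\mathbb{R}/2\pi\mathbb{Z}$ is defined. The untwisted momentum of $v\in\mathcal{X}^1$ is $[p](v)=\lim_{R\to+\infty}\Big(\frac12\int_{-R}^R\langle iv,v'\rangle-\frac12(\arg v(R)-\arg v(-R))\Big)\in\mathbb{R}/\pi\mathbb{Z}$ (this limit exists). Define $\mathfrak{E}_{\min}(\frac{\pi}{2})=\inf\{E(v):\ v\in\mathcal{X}^1,\ [p](v)=\frac{\pi}{2}\bmod\pi\}$. The kink is $\mathfrak{v}_0(x)=\tanh(x/\sqrt2)$. *)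

(* Defs.v *)
(* R : realType, Lebesgue measure on R.
   A complex-valued function v : R -> C is represented by its real and
   imaginary parts (a, b); its derivative by (a', b'). *)
From HB Require Import structures.
From mathcomp Require Import all_boot all_order all_algebra.
From mathcomp Require Import all_classical all_reals all_analysis.
Set Implicit Arguments. Unset Strict Implicit. Unset Printing Implicit Defensive.
Import Order.TTheory GRing.Theory Num.Theory.
Import numFieldNormedType.Exports.
Local Open Scope classical_set_scope.
Local Open Scope ring_scope.

Section Defs.
Variable R : realType.
Notation mu := (@lebesgue_measure R).

(* f' is a (locally integrable) derivative of f in the sense of H^1_loc:
   f is the absolutely continuous function with f y - f x = int_x^y f'. *)
Definition is_prim (f f' : R -> R) : Prop :=
  forall x y : R, x <= y ->
    mu.-integrable `[x, y] (EFin \o f') /\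
    f y - f x = Rintegral mu `[x, y] f'.

Definition L2 (f : R -> R) : Prop :=
  measurable_fun setT f /\ (\int[mu]_x ((f x) ^+ 2)%:E < +oo)%E.

Definition X1 (a b a' b' : R -> R) : Prop :=
  is_prim a a' /\ is_prim b b' /\
  (exists M : R, forall x, a x ^+ 2 + b x ^+ 2 <= M) /\
  L2 a' /\ L2 b' /\ L2 (fun x => 1 - (a x ^+ 2 + b x ^+ 2)).

Definition energy (a b a' b' : R -> R) : \bar R :=
  ((2^-1)%:E * \int[mu]_x ((a' x ^+ 2 + b' x ^+ 2)%:E)
   + (4^-1)%:E * \int[mu]_x (((1 - (a x ^+ 2 + b x ^+ 2)) ^+ 2)%:E))%E.

(* phi is a representative of arg v(r) - arg v(-r) in R/2piZ, i.e.
   with z := v(r) * conj (v(-r)) (nonzero), e^{i phi} = z / |z|.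
   Here Re z = a r a(-r) + b r b(-r), Im z = b r a(-r) - a r b(-r). *)
Definition arg_diff (a b : R -> R) (r phi : R) : Prop :=
  let re := a r * a (- r) + b r * b (- r) in
  let im := b r * a (- r) - a r * b (- r) in
  let m := Num.sqrt (re ^+ 2 + im ^+ 2) in
  0 < m /\ cos phi * m = re /\ sin phi * m = im.

(* <iv, v'> = Re (i v conj v') = a b' - b a' *)
Definition momentum_density (a b a' b' : R -> R) (x : R) : R :=
  a x * b' x - b x * a' x.

(* [p](v) = c mod pi :  the quantity
     1/2 int_{-r}^{r} <iv,v'> - 1/2 (arg v(r) - arg v(-r))   (in R/piZ)
   converges to c in R/piZ as r -> +oo. *)
Definition momentum_is (a b a' b' : R -> R) (c : R) : Prop :=
  forall eps : R, 0 < eps -> exists R0 : R, forall r phi : R,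
    R0 <= r -> arg_diff a b r phi ->
    exists k : int,
      `| 2^-1 * Rintegral mu `[- r, r] (momentum_density a b a' b')
         - 2^-1 * phi - c - k%:~R * pi | < eps.

Definition Emin_pi2 : \bar R :=
  ereal_inf [set e | exists a b a' b' : R -> R,
    [/\ X1 a b a' b', momentum_is a b a' b' (pi / 2) & e = energy a b a' b']].

Definition tanh (x : R) : R := (expR x - expR (- x)) / (expR x + expR (- x)).

Definition kink (x : R) : R := tanh (x / Num.sqrt 2).
End Defs.

(* Main.v *)
(* Write [n = |v|^2] and [w = <iv,v'>].  If [n > m^2 > 0] everywhere, then with
   [q = sqrt (n - m^2)] the energy density minus [(m / sqrt 2) |w (1 - n) / n|] minus
   [(1 / sqrt 2) |(Phi o q)'|], where [Phi s = s - m atan (s / m) - s^3 / 3], is a sum of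
   two squares divided by [2 n].  Since the momentum of a nowhere vanishing [v] is
   [-1/2 int w (1 - n) / n] modulo [pi], a momentum close to [pi/2] forces
   [E v >= 2 sqrt 2 / 3 + c m^2 - o(1)].  The kink has energy [2 sqrt 2 / 3] and momentum
   [pi/2]; hence [inf |u_n|] tends to 0 along a minimizing sequence.

   Centre [u_n] where [|u_n|] is almost minimal.  With the regularized modulus
   [rho = sqrt (n + k^2)], a calibration of Bogomolny type bounds the L^2 norm over a half
   line of what separates [v] from a solution of the first order equation of the kink, as
   both half lines together already cost the energy of the kink.  Hence [rho] is close to
   the kink profile on compact sets, and at positive distance from the centre the phase is
   almost constant on each side.  The momentum forces the two phases to be opposite, which
   gives locally uniform convergence.

   Finally, with [K] the rotated kink, [1/2 |v' - K'|^2 + 1/4 (|v|^2 - |K|^2)^2] is the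
   difference of the energy densities of [v] and [K] plus two terms that, after an
   integration by parts, vanish under locally uniform convergence; the convergence of the
   energies then yields the L^2 convergences. *)
Require Import Defs.
From HB Require Import structures.
From mathcomp Require Import all_boot all_order all_algebra.
From mathcomp Require Import all_classical all_reals all_analysis.
From mathcomp Require Import measurable_realfun ring lra.
Import Order.TTheory GRing.Theory Num.Theory.
Import numFieldNormedType.Exports.
Local Open Scope classical_set_scope.
Local Open Scope ring_scope.

Set Implicit Arguments.
Unset Strict Implicit.
Unset Printing Implicit Defensive.

Local Notation Int x y f := (Rintegral (@lebesgue_measure _) `[x, y] f).
Local Notation locint f := (locally_integrable [set: _] f).

Ltac continuity :=
  let cf := fresh in let cg := fresh in let z := fresh in
  lazymatch goal with
  | |- continuous (fun t => @?f t + @?g t) =>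
      cut (continuous f); [cut (continuous g); [|continuity]|continuity];
      intros cg cf z; exact: cvgD (cf z) (cg z)
  | |- continuous (fun t => - @?f t) =>
      cut (continuous f); [|continuity]; intros cf z; exact: cvgN (cf z)
  | |- continuous (fun t => @?f t * @?g t) =>
      cut (continuous f); [cut (continuous g); [|continuity]|continuity];
      intros cg cf z; exact: cvgM (cf z) (cg z)
  | |- continuous (fun t => @?f t ^+ ?n) =>
      cut (continuous f); [|continuity];
      intros cf z; exact: continuous_comp (cf z) (@exprn_continuous _ n _)
  | |- _ => first [assumption | move=> z; exact: cvg_cst]
  end.

Section locally_integrable_functions.
Context {R : realType}.
Notation mu := (@lebesgue_measure R).
Implicit Types (f g : R -> R) (x y c : R).

Lemma bigcup_segment : \bigcup_n `[- n%:R, n%:R]%classic = [set: R].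
Proof.
apply/seteqP; split => // t _; exists (Num.bound `|t|) => //=.
by rewrite in_itv/= -ler_norml; apply: ltW; apply: archi_boundP.
Qed.

Lemma locintP f : (forall x y, mu.-integrable `[x, y] (EFin \o f)) <-> locint f.
Proof.
split=> [fi|[mf _ fi] x y]; last first.
  apply/integrableP; split; first exact/measurable_EFinP/measurable_funTS.
  by apply: (fi `[x, y]%classic) => //; exact: segment_compact.
have mf : measurable_fun setT f.
  rewrite -bigcup_segment; apply/measurable_fun_bigcup => // n.
  by have /integrableP[/measurable_EFinP] := fi (- n%:R) n%:R.
split=> [//||K _ cK]; first exact: openT.
have [M [_ KM]] := compact_bounded cK.
have /integrableP[_] := fi (- (`|M| + 1)) (`|M| + 1); apply: le_lt_trans.
apply: ge0_subset_integral => //.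
- exact: compact_measurable.
- by apply/measurable_EFinP/measurable_funTS; exact: measurableT_comp.
move=> t Kt /=; rewrite in_itv/= -ler_norml; apply: KM => //.
by rewrite (le_lt_trans (ler_norm _))// ltrDl.
Qed.

Lemma locint_integrable f : locint f -> forall x y, mu.-integrable `[x, y] (EFin \o f).
Proof. by move/locintP. Qed.

Lemma locint_measurable f : locint f -> measurable_fun setT f.
Proof. by case. Qed.

Lemma continuous_locint f : continuous f -> locint f.
Proof.
move=> cf; apply/locintP => x y; apply: continuous_compact_integrable.
  exact: segment_compact.
exact: continuous_subspaceT.
Qed.

Lemma locint_cst c : locint (fun=> c : R).
Proof. by apply: continuous_locint => x; exact: cvg_cst. Qed.

Lemma locintM f g : continuous f -> locint g -> locint (fun t => f t * g t).
Proof.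
move=> cf lg; apply/locintP => x y.
have -> : EFin \o (fun t => f t * g t) = ((EFin \o f) \* (EFin \o g))%E.
  by apply/funext => t; rewrite /= EFinM.
apply: integrableMr => //; last exact: locint_integrable.
  by apply: subspace_continuous_measurable_fun => //; exact: continuous_subspaceT.
have cK : compact (f @` `[x, y]).
  by apply: continuous_compact; [exact: continuous_subspaceT|exact: segment_compact].
have [M [Mr Mf]] := compact_bounded cK.
by exists M; split => // e Me t xy; apply: Mf => //; exists t.
Qed.

Lemma locintD f g : locint f -> locint g -> locint (fun t => f t + g t).
Proof. exact: locally_integrableD. Qed.

Lemma locintB f g : locint f -> locint g -> locint (fun t => f t - g t).
Proof. exact: locally_integrableB. Qed.

Lemma locintZ c f : locint f -> locint (fun t => c * f t).
Proof. by apply: locintM => x; exact: cvg_cst. Qed.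

Lemma locint_norm f : locint f -> locint (fun t => `|f t|).
Proof.
by move=> lf; apply/locintP => x y; exact/integrable_norm/locint_integrable.
Qed.

End locally_integrable_functions.

Section segment_integrals.
Context {R : realType}.
Implicit Types (f g h : R -> R) (x y z c : R).

Lemma IntD x y f g : locint f -> locint g ->
  Int x y (fun t => f t + g t) = Int x y f + Int x y g.
Proof. by move=> lf lg; apply: RintegralD => //; exact: locint_integrable. Qed.

Lemma IntB x y f g : locint f -> locint g ->
  Int x y (fun t => f t - g t) = Int x y f - Int x y g.
Proof. by move=> lf lg; apply: RintegralB => //; exact: locint_integrable. Qed.

Lemma IntZ x y c f : locint f -> Int x y (fun t => c * f t) = c * Int x y f.
Proof. by move=> lf; apply: RintegralZl => //; exact: locint_integrable. Qed.

Lemma le_Int x y f g : locint f -> locint g ->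
  (forall t, x <= t <= y -> f t <= g t) -> Int x y f <= Int x y g.
Proof.
move=> lf lg fg; by apply: le_Rintegral => //; exact: locint_integrable.
Qed.

Lemma eq_Int x y f g : (forall t, x <= t <= y -> f t = g t) -> Int x y f = Int x y g.
Proof. by move=> fg; apply: eq_Rintegral => t; rewrite inE/= in_itv/=; exact: fg. Qed.

Lemma Int_ge0 x y f : (forall t, x <= t <= y -> 0 <= f t) -> 0 <= Int x y f.
Proof. by move=> f0; apply: Rintegral_ge0 => t /=; rewrite in_itv/=; exact: f0. Qed.

Lemma Int_cst x y c : x <= y -> Int x y (fun=> c) = c * (y - x).
Proof.
move=> xy; rewrite Rintegral_cst//= lebesgue_measure_itv/= lte_fin.
by case: ltgtP xy => //= -> _; rewrite subrr.
Qed.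

Lemma Int_ge x y f : y <= x -> Int x y f = 0.
Proof.
rewrite le_eqVlt => /predU1P[->|yx]; first by rewrite set_itv1 Rintegral_set1.
by rewrite set_itv_ge ?Rintegral_set0// bnd_simp -ltNge.
Qed.

Lemma Int_cat x y z f : locint f -> x <= y -> y <= z ->
  Int x z f = Int x y f + Int y z f.
Proof.
move=> lf xy yz; have fi := locint_integrable lf.
have := @Rintegral_itvB R f (BLeft x) (BRight z) y (fi _ _).
rewrite !bnd_simp => /(_ xy yz) E.
rewrite Rintegral_itv_obnd_cbnd in E; first by rewrite -E addrC subrK.
by apply: integrableS (fi y z) => //; apply: subset_itv => //; rewrite bnd_simp.
Qed.

Lemma Int_norm x y f : locint f -> `|Int x y f| <= Int x y (fun t => `|f t|).
Proof. by move=> lf; apply: le_normr_Rintegral => //; exact: locint_integrable. Qed.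

Lemma Int_norm_le x y f g : locint f -> locint g ->
  (forall t, x <= t <= y -> `|f t| <= g t) -> `|Int x y f| <= Int x y g.
Proof.
move=> lf lg fg; apply: (le_trans (Int_norm _ _ lf)); apply: le_Int => //.
exact: locint_norm.
Qed.

Lemma Int_sub x y s t f : locint f -> (forall r, 0 <= f r) ->
  s <= x -> x <= y -> y <= t -> Int x y f <= Int s t f.
Proof.
move=> lf f0 sx xy yt.
rewrite (Int_cat lf sx (le_trans xy yt)) (Int_cat lf xy yt).
have := @Int_ge0 s x f (fun r _ => f0 r); have := @Int_ge0 y t f (fun r _ => f0 r).
by lra.
Qed.

Lemma cauchy_schwarz_Int x y f g h : locint f -> locint g -> locint h ->
  (forall t, x <= t <= y -> 0 <= f t) -> (forall t, x <= t <= y -> 0 <= g t) ->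
  (forall t, x <= t <= y -> h t ^+ 2 <= f t * g t) ->
  Int x y h ^+ 2 <= Int x y f * Int x y g.
Proof.
move=> lf lg lh f0 g0 hfg.
set F := Int x y f; set G := Int x y g; set H := Int x y h.
pose p := Poly [:: G; 2 * H; F].
suff : p`_1 ^+ 2 - 4 * p`_2 * p`_0 <= 0 by rewrite !coefE /=; lra.
apply: deg_le2_poly_ge0 => [|r]; first by rewrite size_Poly.
have -> : p.[r] = Int x y (fun t => r ^+ 2 * f t + 2 * r * h t + g t).
  rewrite !(IntD, IntZ)//; try by [exact: locintZ|apply: locintD; exact: locintZ].
  by rewrite -/F -/G -/H horner_Poly/=; ring.
apply: Int_ge0 => t xty; have [[ft gt] hf] := (f0 t xty, g0 t xty, hfg t xty).
have [f_eq0|f_neq0] := eqVneq (f t) 0.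
  have /eqP : h t ^+ 2 = 0 by have := sqr_ge0 (h t); move: hf; rewrite f_eq0; lra.
  by rewrite sqrf_eq0 f_eq0 => /eqP ->; rewrite !mulr0 !add0r.
rewrite -(pmulr_rge0 _ (_ : 0 < f t)) ?lt0r ?f_neq0//.
have -> : f t * (r ^+ 2 * f t + 2 * r * h t + g t) =
  (r * f t + h t) ^+ 2 + (f t * g t - h t ^+ 2) by ring.
by rewrite addr_ge0 ?sqr_ge0 ?subr_ge0.
Qed.

Lemma sqr_Int_le x y f h : locint f -> locint h -> x <= y ->
  (forall t, x <= t <= y -> h t ^+ 2 <= f t) -> Int x y h ^+ 2 <= (y - x) * Int x y f.
Proof.
move=> lf lh xy hf; rewrite -[y - x]mul1r -Int_cst//.
apply: cauchy_schwarz_Int => // [|t xty|t xty]; first exact: locint_cst.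
- exact: le_trans (sqr_ge0 _) (hf t xty).
- by rewrite mul1r hf.
Qed.

End segment_integrals.

Section primitives.
Context {R : realType}.
Implicit Types (f g F : R -> R) (x y c : R).

Lemma prim_locint f f' : is_prim f f' -> locint f'.
Proof.
move=> ff; apply/locintP => x y; have [xy|yx] := leP x y; first by have [] := ff x y xy.
by rewrite set_itv_ge ?bnd_simp -?ltNge//; exact: integrable_set0.
Qed.

Lemma primP f f' : locint f' ->
  (forall x y, x <= y -> Int x y f' = f y - f x) -> is_prim f f'.
Proof.
by move=> lf fE x y xy; split; [exact: locint_integrable|rewrite fE].
Qed.

Lemma primE f f' x y : is_prim f f' -> x <= y -> Int x y f' = f y - f x.
Proof. by move=> ff xy; have [_ ->] := ff x y xy. Qed.

Lemma prim_continuous f f' : is_prim f f' -> continuous f.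
Proof.
move=> ff z.
have zz : z - 1 < z + 1 by lra.
have := @parameterized_integral_continuous R (z - 1) (z + 1) f' (ltW zz).
move=> /(_ (locint_integrable (prim_locint ff) _ _)).
move=> /(continuous_within_itvP _ zz)[/(_ z)].
rewrite in_itv/= => /(_ _)/cvgrPdist_lt => cI _ _.
apply/cvgrPdist_lt => e e0; have /cI : z - 1 < z < z + 1 by lra.
move=> /(_ e e0) Ie; near=> t.
have zt : z - 1 < t by near: t; apply: lt_nbhsr; lra.
have -> : f z - f t = Int (z - 1) z f' - Int (z - 1) t f'.
  by rewrite !(primE ff) ?(ltW zt)//; lra.
by near: t; exact: Ie.
Unshelve. all: by end_near. Qed.

Lemma eq_prim f f' h h' : is_prim f f' -> f =1 h -> f' =1 h' -> is_prim h h'.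
Proof. by move=> pf /funext <- /funext <-. Qed.

Lemma primD f f' g g' : is_prim f f' -> is_prim g g' ->
  is_prim (fun t => f t + g t) (fun t => f' t + g' t).
Proof.
move=> pf pg; have [lf lg] := (prim_locint pf, prim_locint pg).
apply: primP => [|x y xy]; first exact: locintD.
by rewrite IntD// (primE pf)// (primE pg)//; ring.
Qed.

Lemma primZ c f f' : is_prim f f' -> is_prim (fun t => c * f t) (fun t => c * f' t).
Proof.
move=> pf; have lf := prim_locint pf.
apply: primP => [|x y xy]; first exact: locintZ.
by rewrite IntZ// (primE pf)//; ring.
Qed.

Lemma primB f f' g g' : is_prim f f' -> is_prim g g' ->
  is_prim (fun t => f t - g t) (fun t => f' t - g' t).
Proof.
by move=> pf /(primZ (-1)) /(primD pf) /eq_prim; apply => t; rewrite mulN1r.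
Qed.

Lemma prim_cst c : is_prim (fun=> c : R) (fun=> 0).
Proof.
apply: primP => [|x y xy]; first exact: locint_cst.
by rewrite Int_cst// mul0r subrr.
Qed.

Lemma prim_id : is_prim (@id R) (fun=> 1).
Proof.
by apply: primP => [|x y xy]; [exact: locint_cst|rewrite Int_cst// mul1r].
Qed.

Lemma prim_ndecr f f' : is_prim f f' -> (forall t, 0 <= f' t) ->
  {homo f : x y / x <= y}.
Proof.
by move=> pf f'0 x y xy; rewrite -subr_ge0 -(primE pf xy); exact: Int_ge0.
Qed.

Lemma prim_dist_le f f' g g' x y : is_prim f f' -> is_prim g g' ->
  (forall t, Num.min x y <= t <= Num.max x y -> `|f' t| <= g' t) ->
  `|f y - f x| <= `|g y - g x|.
Proof.
move=> pf pg; have dist_le s t : s <= t -> (forall r, s <= r <= t -> `|f' r| <= g' r) ->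
    `|f t - f s| <= `|g t - g s|.
  move=> st fg; apply: le_trans (ler_norm _).
  rewrite -(primE pf st) -(primE pg st).
  by apply: Int_norm_le => //; [exact: prim_locint pf|exact: prim_locint pg].
have [xy|/ltW yx] := leP x y; first exact: dist_le.
by rewrite distrC (distrC (g y)); exact: dist_le.
Qed.

Lemma exists_prim f x c : locint f -> exists2 F, is_prim F f & F x = c.
Proof.
move=> lf; exists (fun t => c + (Int x t f - Int t x f)); last by rewrite !Int_ge// subrr addr0.
apply: primP => // s t st.
have [xs|/ltW sx] := leP x s; last have [xt|/ltW tx] := leP x t.
- have xt := le_trans xs st.
  by rewrite (Int_ge _ xs) (Int_ge _ xt) (Int_cat lf xs st); ring.
- by rewrite (Int_ge _ sx) (Int_ge _ xt) (Int_cat lf sx xt); ring.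
- by rewrite (Int_ge _ sx) (Int_ge _ tx) (Int_cat lf st tx); ring.
Qed.

End primitives.

Section chain_rule.
Context {R : realType}.
Implicit Types (f g F P : R -> R) (x y z c e : R).

Lemma near_ndecr_le f x y : x <= y ->
  (forall z, \forall t \near z, (t <= z -> f t <= f z) /\ (z <= t -> f z <= f t)) ->
  f x <= f y.
Proof.
move=> xy fnear.
pose S := [set t | x <= t <= y /\ f x <= f t].
have Sx : S x by split; rewrite /= ?lexx.
have supS : has_sup S by split; [exists x|exists y => t [/andP[]]].
pose z := sup S; have [d /= d0 fz] := fnear z.
have zy : z <= y by apply: ge_sup; [exists x|move=> t [/andP[]]].
have Sz : S z.
  have xz : x <= z by apply: ub_le_sup => //; case: supS.
  split; first by rewrite xz.
  have [s Ss zs] := sup_adherent d0 supS.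
  have sz : s <= z by apply: ub_le_sup => //; case: supS.
  have [|+ _] := fz s; first by rewrite /= ger0_norm ?subr_ge0//; rewrite -/z in zs; lra.
  by move=> /(_ sz); apply: le_trans; case: Ss.
move: zy; rewrite le_eqVlt => /predU1P[<-|zy]; first by case: Sz.
pose t := Num.min y (z + d / 2).
have zt : z < t by rewrite lt_min zy/=; lra.
have td : t <= z + d / 2 by rewrite ge_min lexx orbT.
have [|_ /(_ (ltW zt)) fzt] := fz t; first by rewrite /= ltr0_norm ?subr_lt0//; lra.
have [/andP[xz _] fxz] := Sz.
suff /(ub_le_sup (proj2 supS)) : S t by rewrite leNgt zt.
by split; [rewrite (le_trans xz (ltW zt)) ge_min lexx|exact: le_trans fzt].
Qed.

Lemma cst_of_negligible_increments f P : {homo P : x y / x <= y} ->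
  (forall z e, 0 < e -> \forall t \near z, `|f t - f z| <= e * `|P t - P z|) ->
  forall x y, f x = f y.
Proof.
move=> Pm fP; suff le_f x y : x <= y -> f y - f x = 0.
  move=> x y; apply/eqP; rewrite -subr_eq0; apply/eqP.
  by have [/ltW/le_f|/le_f/eqP] := ltP y x; last by rewrite -oppr_eq0 opprB => /eqP.
move=> xy; apply/eqP; rewrite -normr_le0; apply/ler_addgt0Pl => e e0; rewrite addr0.
have P0 : 0 < P y - P x + 1 by rewrite ltr_wpDl// subr_ge0; exact: Pm.
pose r := e / (P y - P x + 1); have r0 : 0 < r by rewrite divr_gt0.
have near_z s : `|s| = 1 -> r * P x + s * f x <= r * P y + s * f y.
  move=> s1; apply: (@near_ndecr_le (fun t => r * P t + s * f t)) => // z.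
  near=> t; have : `|f t - f z| <= r * `|P t - P z| by near: t; exact: fP.
  rewrite -[`|f t - f z|]mul1r -s1 -normrM => fPt.
  by split=> /Pm Pzt; move: fPt; rewrite ler_norml;
    [rewrite ler0_norm ?subr_le0|rewrite ger0_norm ?subr_ge0]; lra.
have := near_z 1 (normr1 _); have := near_z (-1) (normrN1 _).
have -> : e = r * (P y - P x + 1) by rewrite divfK ?gt_eqF.
by rewrite ler_norml; lra.
Unshelve. all: by end_near. Qed.

Lemma near_between (A : set R) z : (\forall t \near z, A t) ->
  \forall t \near z, forall r, Num.min z t <= r <= Num.max z t -> A r.
Proof.
move=> [d /= d0 Ad]; exists d => // t /= td r zrt; apply: Ad => /=.
by move: td zrt; rewrite !ltr_norml; case: (leP z t); lra.
Qed.

Lemma is_derive1_near F c dF e : is_derive c 1 F dF -> 0 < e ->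
  \forall h \near c, `|F h - F c - dF * (h - c)| <= e * `|h - c|.
Proof.
move=> [dFc <-] e0.
have [d /= d0 quot] := proj1 (@cvgrPdist_le _ _ _ _ _ _ _) dFc e e0.
exists d => // h /= hc; have [->|h_neq_c] := eqVneq h c.
  by rewrite !subrr mulr0 subrr !normr0 mulr0.
have hc0 : h - c != 0 by rewrite subr_eq0.
have := quot (h - c); rewrite /= sub0r opprB => /(_ hc hc0).
rewrite /GRing.scale/= mulr1 subrK -(@ler_pM2r _ `|h - c|) ?normr_gt0// -normrM.
by rewrite mulrBl mulrAC mulVf// mul1r distrC.
Qed.

Lemma prim_comp F F' f f' : is_prim f f' ->
  (forall z, is_derive (f z) 1 F (F' (f z))) ->
  (forall z, {for f z, continuous F'}) ->
  is_prim (fun t => F (f t)) (fun t => F' (f t) * f' t).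
Proof.
move=> pf dF cF; have lf := prim_locint pf; have cf := prim_continuous pf.
have lh : locint (fun t => F' (f t) * f' t).
  by apply: locintM => // z; apply: continuous_comp; [exact: cf|exact: cF].
have [G pG _] := exists_prim 0 0 lh.
have [P pP _] := exists_prim 0 0 (locint_norm lf).
suff FG x y : F (f x) - G x = F (f y) - G y.
  by apply: primP => // x y xy; rewrite (primE pG)//; have := FG x y; lra.
apply: (@cst_of_negligible_increments (fun t => F (f t) - G t) P) => [|z e e0].
  by apply: prim_ndecr pP _ => t; exact: normr_ge0.
have e2 : 0 < e / 2 by lra.
set c := F' (f z); have cf_z : f @ z --> f z := cf z.
have dFz := cf_z _ (is_derive1_near (dF z) e2).
have cF'f : \forall r \near z, `|c - F' (f r)| <= e / 2.
  exact: (proj1 (@cvgrPdist_le _ _ _ _ _ _ _) (cvg_comp _ _ cf_z (cF z)) _ e2).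
near=> t.
have Ft : `|F (f t) - F (f z) - c * (f t - f z)| <= e / 2 * `|P t - P z|.
  apply: (@le_trans _ _ (e / 2 * `|f t - f z|)); first by near: t.
  by rewrite ler_pM2l//; exact: prim_dist_le pf pP _.
have Gt : `|(G t - c * f t) - (G z - c * f z)| <= `|e / 2 * P t - e / 2 * P z|.
  apply: (prim_dist_le (primB pG (primZ c pf)) (primZ (e / 2) pP)) => r.
  rewrite -mulrBl normrM => zrt; rewrite ler_wpM2r// distrC; move: r zrt.
  by near: t; exact: near_between cF'f.
rewrite -mulrBr normrM gtr0_norm// in Gt.
have -> : F (f t) - G t - (F (f z) - G z) =
  (F (f t) - F (f z) - c * (f t - f z)) - (G t - c * f t - (G z - c * f z)) by ring.
by apply: (le_trans (ler_normB _ _)); lra.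
Unshelve. all: by end_near. Qed.

Lemma prim_sqr f f' : is_prim f f' -> is_prim (fun t => f t ^+ 2) (fun t => 2 * f t * f' t).
Proof.
move=> pf; apply: (prim_comp (F := fun s => s ^+ 2) (F' := fun s => 2 * s) pf) => z.
  by apply: is_derive_eq; rewrite /GRing.scale/= mulr1 mulr_natl.
by apply: cvgM; [exact: cvg_cst|exact: cvg_id].
Qed.

Lemma primM f f' g g' : is_prim f f' -> is_prim g g' ->
  is_prim (fun t => f t * g t) (fun t => g t * f' t + f t * g' t).
Proof.
move=> pf pg; have psq := prim_sqr (primD pf pg).
have := primZ 2^-1 (primB (primB psq (prim_sqr pf)) (prim_sqr pg)).
by move=> /eq_prim; apply => t /=; field.
Qed.

Lemma prim_sqrt f f' : is_prim f f' -> (forall t, 0 < f t) ->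
  is_prim (fun t => Num.sqrt (f t)) (fun t => (2 * Num.sqrt (f t))^-1 * f' t).
Proof.
move=> pf f0; apply: (prim_comp (F' := fun s => (2 * Num.sqrt s)^-1) pf) => z.
  exact: is_derive1_sqrt.
apply: cvgV; first by rewrite mulf_neq0 ?gt_eqF ?sqrtr_gt0.
by apply: cvgM; [exact: cvg_cst|exact: sqrt_continuous].
Qed.

Lemma prim_cos f f' : is_prim f f' -> is_prim (cos \o f) (fun t => - sin (f t) * f' t).
Proof.
move=> pf; apply: (prim_comp (F' := fun s => - sin s) pf) => z.
by apply: cvgN; exact: continuous_sin.
Qed.

Lemma prim_sin f f' : is_prim f f' -> is_prim (sin \o f) (fun t => cos (f t) * f' t).
Proof. by move=> pf; apply: prim_comp pf _ _ => z; exact: continuous_cos. Qed.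

Lemma prim_expR f f' : is_prim f f' -> is_prim (expR \o f) (fun t => expR (f t) * f' t).
Proof. by move=> pf; apply: prim_comp pf _ _ => z; exact: continuous_expR. Qed.

Lemma prim_derive F F' : (forall t : R, is_derive t 1 F (F' t)) -> continuous F' -> is_prim F F'.
Proof.
move=> dF cF'; apply: (eq_prim (prim_comp (@prim_id R) dF cF')) => // t.
by rewrite mulr1.
Qed.

End chain_rule.

Section linear_ode.
Context {R : realType}.
Implicit Types (f g j : R -> R) (x y : R).

Lemma Int_integrating_factor f f' g G x y : is_prim f f' -> is_prim G g -> x <= y ->
  Int x y (fun t => (f' t + g t * f t) * expR (G t)) = f y * expR (G y) - f x * expR (G x).
Proof.
move=> pf /prim_expR /(primM pf) pfG xy.
by rewrite -(primE pfG xy); apply: eq_Int => t _; rewrite /=; ring.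
Qed.

Lemma linear_ode_sol f f' g x y : is_prim f f' -> locint g -> x <= y ->
  (forall t, x <= t <= y -> f' t = g t * f t) -> f y = f x * expR (Int x y g).
Proof.
move=> pf lg xy f'E; have [G pG _] := exists_prim 0 0 lg.
have := Int_integrating_factor pf (primZ (-1) pG) xy.
rewrite (@eq_Int _ _ _ _ (fun=> 0)) => [|t /f'E ->]; last by rewrite !mulN1r; ring.
rewrite Int_cst// mul0r !mulN1r => /esym/eqP; rewrite subr_eq0 => /eqP fG.
by rewrite (primE pG xy) addrC expRD mulrA -fG -mulrA -expRD addNr expR0 mulr1.
Qed.

Lemma damped_ode_le f f' g j x y : is_prim f f' -> locint g -> locint j -> x <= y ->
  (forall t, x <= t <= y -> 0 <= g t) ->
  (forall t, x <= t <= y -> f' t = j t - g t * f t) ->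
  `|f y| <= `|f x| + Int x y (fun t => `|j t|).
Proof.
move=> pf lg lj xy g0 f'E; have [G pG _] := exists_prim 0 0 lg.
have Gy t : x <= t <= y -> expR (G t) <= expR (G y).
  move=> /andP[xt ty]; rewrite ler_expR -subr_ge0 -(primE pG ty).
  by apply: Int_ge0 => s /andP[ts sy]; rewrite g0// (le_trans xt ts).
have cG := prim_continuous (prim_expR pG).
have jG : `|f y * expR (G y) - f x * expR (G x)| <= expR (G y) * Int x y (fun t => `|j t|).
  rewrite -(Int_integrating_factor pf pG xy) -IntZ; last exact: locint_norm.
  rewrite (@eq_Int _ _ _ _ (fun t => expR (G t) * j t)) => [|t /f'E ->]; last by ring.
  apply: Int_norm_le => [||t /Gy ty]; [exact: locintM|exact/locintZ/locint_norm|].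
  by rewrite normrM ger0_norm ?expR_ge0// ler_wpM2r.
have e0 := expR_gt0 (G y); rewrite -(ler_pM2l e0) mulrDr.
have := lerB_dist (f y * expR (G y)) (f x * expR (G x)).
rewrite !normrM !(ger0_norm (expR_ge0 _)) mulrC => fyx.
have : `|f x| * expR (G x) <= expR (G y) * `|f x| by rewrite mulrC ler_wpM2r// Gy// lexx.
by lra.
Qed.

End linear_ode.

Section measure_preserving_maps.
Context {R : realType}.
Notation mu := (@lebesgue_measure R).
Variable phi : R -> R.
Hypothesis mphi : measurable_fun [set: measurableTypeR R] (phi : _ -> measurableTypeR R).
Hypothesis phi_mu : forall A : set R, measurable A ->
  pushforward mu (phi : _ -> measurableTypeR R) A = mu A.

Lemma integrable_comp (D : set R) (f : R -> R) : measurable D -> measurable_fun setT f ->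
  mu.-integrable D (EFin \o f) -> mu.-integrable (phi @^-1` D) (EFin \o (f \o phi)).
Proof.
move=> mD mf /integrableP[_ fD]; apply/integrableP; split.
  by apply/measurable_EFinP/measurable_funTS; exact: measurableT_comp.
apply: le_lt_trans fD.
rewrite -(@ge0_integral_pushforward _ _ _ _ R _ mphi mu D (fun t => `|(f t)%:E|%E))//.
  by rewrite (eq_measure_integral mu) // => A mA _; exact: phi_mu.
by apply: measurable_funTS; apply: measurableT_comp => //; exact/measurable_EFinP.
Qed.

Lemma Rintegral_comp (D : set R) (f : R -> R) : measurable D -> measurable_fun setT f ->
  mu.-integrable D (EFin \o f) -> Rintegral mu (phi @^-1` D) (f \o phi) = Rintegral mu D f.
Proof.
move=> mD mf fD; congr fine.
have /(_ _ _)/= <- // := @integral_pushforward _ _ _ _ R _ mphi mu D (EFin \o f) _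
  (integrable_comp mD mf fD).
  by apply: eq_measure_integral => A mA _; exact: phi_mu.
exact/measurable_EFinP.
Qed.

End measure_preserving_maps.

Section translations_and_reflections.
Context {R : realType}.
Notation mu := (@lebesgue_measure R).
Implicit Types (f : R -> R) (x y c : R).

Lemma measurable_translation c :
  measurable_fun setT ((fun t : R => t + c) : _ -> measurableTypeR R).
Proof. exact: measurable_funD. Qed.

Lemma measurable_reflection : measurable_fun setT ((-%R : R -> R) : _ -> measurableTypeR R).
Proof. exact: measurable_funN. Qed.

Lemma preimage_translation c (x y : R) :
  (fun t => t + c) @^-1` `[x + c, y + c] = `[x, y]%classic.
Proof. by apply/seteqP; split => t /=; rewrite !in_itv/= !lerD2r. Qed.

Lemma preimage_reflection (x y : R) : -%R @^-1` `[- y, - x] = `[x, y]%classic.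
Proof. by apply/seteqP; split => t /=; rewrite !in_itv/= !lerN2 andbC. Qed.

Lemma lebesgue_measure_translation c (A : set R) : measurable A ->
  pushforward mu ((fun t => t + c) : _ -> measurableTypeR R) A = mu A.
Proof.
pose phi : {mfun R >-> measurableTypeR R} := HB.pack ((fun t => t + c) : R -> measurableTypeR R)
  (isMeasurableFun.Build _ _ _ _ _ (measurable_translation c)).
move=> mA; apply/esym.
apply: (@lebesgue_measure_unique R (pushforward mu phi)) => //=.
  exact: measurable_translation.
move=> _ _ [[u v]] _ <-.
rewrite /pushforward.
have -> : (fun t => t + c) @^-1` [set` `]u, v]] = [set` `]u - c, v - c]].
  by apply/seteqP; split => t /=; rewrite !in_itv/= ltrBlDr lerBrDr.
rewrite !lebesgue_measure_itv/= !lte_fin ltrD2r; case: ifP => // _.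
by congr EFin; ring.
Qed.

Lemma locint_translate c f : locint f -> locint (fun t => f (t + c)).
Proof.
move=> lf; apply/locintP => x y; rewrite -(preimage_translation c).
apply: (integrable_comp (measurable_translation c) (@lebesgue_measure_translation c)) => //.
  exact: locint_measurable.
exact: locint_integrable.
Qed.

Lemma Int_translate c x y f : locint f -> Int x y (fun t => f (t + c)) = Int (x + c) (y + c) f.
Proof.
move=> lf; rewrite -(preimage_translation c).
apply: (Rintegral_comp (measurable_translation c) (@lebesgue_measure_translation c)) => //.
  exact: locint_measurable.
exact: locint_integrable.
Qed.

Lemma locint_reflect f : locint f -> locint (fun t => f (- t)).
Proof.
move=> lf; apply/locintP => x y; rewrite -preimage_reflection.
apply: (integrable_comp measurable_reflection (@lebesgue_measureN R)) => //.
  exact: locint_measurable.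
exact: locint_integrable.
Qed.

Lemma Int_reflect x y f : locint f -> Int x y (fun t => f (- t)) = Int (- y) (- x) f.
Proof.
move=> lf; rewrite -preimage_reflection.
apply: (Rintegral_comp measurable_reflection (@lebesgue_measureN R)) => //.
  exact: locint_measurable.
exact: locint_integrable.
Qed.

Lemma prim_translate c f f' : is_prim f f' ->
  is_prim (fun t => f (t + c)) (fun t => f' (t + c)).
Proof.
move=> pf; have lf := prim_locint pf; apply: primP => [|x y xy]; first exact: locint_translate.
by rewrite Int_translate// (primE pf)// lerD2r.
Qed.

Lemma prim_reflect f f' : is_prim f f' -> is_prim (fun t => f (- t)) (fun t => - f' (- t)).
Proof.
move=> pf; have lf := prim_locint pf; have lr := locint_reflect lf.
apply: (@eq_prim _ (fun t => f (- t)) (fun t => -1 * f' (- t))) => [|//|t]; last by rewrite mulN1r.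
apply: primP => [|x y xy]; first exact: locintZ.
by rewrite IntZ// Int_reflect// (primE pf) ?lerN2//; ring.
Qed.

End translations_and_reflections.

Section integrals_over_the_line.
Context {R : realType}.
Notation mu := (@lebesgue_measure R).
Implicit Types f : R -> R.

Lemma integrable_locint f : mu.-integrable setT (EFin \o f) -> locint f.
Proof. exact: (open_integrable_locally openT). Qed.

Lemma integral_leP f C : locint f -> (forall t, 0 <= f t) ->
  ((\int[mu]_t (f t)%:E <= C%:E)%E <-> forall x y, x <= y -> Int x y f <= C).
Proof.
move=> lf f0; have fi := locint_integrable lf.
have mf : measurable_fun setT (EFin \o f) by apply/measurable_EFinP; exact: locint_measurable.
split=> [fC x y _|fC].
  rewrite -lee_fin fineK; last exact: integrable_fin_num.
  apply: le_trans fC; apply: ge0_subset_integral => // t _.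
  by rewrite lee_fin.
have := @ge0_nondecreasing_set_cvg_integral _ _ R
  (fun n => (`[- n%:R, n%:R]%classic : set (measurableTypeR R))) (EFin \o f) mu.
rewrite bigcup_segment => cvg_f; apply: cvge_le (cvg_f _ _ _ _) => //.
- near=> n; rewrite -[leLHS]fineK; last exact: integrable_fin_num.
  by rewrite lee_fin; apply: fC; have : 0 <= n%:R :> R by []; lra.
- by move=> m n mn; apply/subsetPset/subset_itv; rewrite bnd_simp ?lerN2 ler_nat.
- by move=> n; exact: measurable_funTS.
- by move=> n t _; rewrite lee_fin.
Unshelve. all: by end_near. Qed.

Lemma exists_small_value f C : locint f -> (forall t, 0 <= f t) ->
  (forall x y, x <= y -> Int x y f <= C) ->
  forall x e, 0 < e -> exists2 t, x <= t & f t < e.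
Proof.
move=> lf f0 fC x e e0; apply: contrapT => no_t.
have fe t : x <= t -> e <= f t.
  by move=> xt; rewrite leNgt; apply/negP => fte; apply: no_t; exists t.
have C0 : 0 <= C by have := fC x x (lexx x); rewrite Int_ge.
have xT : x <= x + (C + 1) / e by rewrite lerDl divr_ge0 ?(ltW e0)//; lra.
have : Int x (x + (C + 1) / e) (fun=> e) <= C.
  apply: le_trans (fC _ _ xT); apply: le_Int => //; first exact: locint_cst.
  by move=> t /andP[/fe].
rewrite Int_cst// addrAC subrr add0r mulrC divfK ?gt_eqF//; lra.
Qed.

End integrals_over_the_line.

Section trigonometry.
Context {R : realType}.
Implicit Types (x y c s : R).

Lemma cos_lipschitz x y : `|cos x - cos y| <= `|x - y|.
Proof.
wlog xy : x y / x <= y.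
  move=> th; have [/th//|/ltW/th] := leP x y.
  by rewrite distrC (distrC y).
have [|c _] := @MVT_segment R cos (fun t => - sin t) x y xy.
  by apply: continuous_subspaceT; exact: continuous_cos.
rewrite distrC (distrC x) => ->; rewrite normrM normrN ler_piMl//; exact: sin_max.
Qed.

Lemma sin_lipschitz x y : `|sin x - sin y| <= `|x - y|.
Proof.
by rewrite -!cosBpihalf; apply: (le_trans (cos_lipschitz _ _)); rewrite opprB addrA subrK.
Qed.

Lemma exists_angle c s : c ^+ 2 + s ^+ 2 = 1 ->
  exists2 t, `|t| <= pi & cos t = c /\ sin t = s.
Proof.
move=> cs.
have cb : -1 <= c <= 1 by have := sqr_ge0 s; nra.
have ss : Num.sqrt (1 - c ^+ 2) = `|s| by rewrite -sqrtr_sqr; congr Num.sqrt; lra.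
have cK : cos (acos c) = c by apply: acosK; rewrite in_itv.
have [p0 pp] := (acos_ge0 cb, acos_lepi cb).
have [s0|s0] := leP 0 s.
  exists (acos c); first by rewrite ger0_norm.
  by rewrite sin_acos// ss ger0_norm.
exists (- acos c); first by rewrite normrN ger0_norm.
by rewrite cosN sinN sin_acos// ss ltr0_norm// opprK.
Qed.

Lemma cosD2kpi x (k : int) : cos (x + 2 * (k%:~R * pi)) = cos x.
Proof.
have cosD2npi n y : cos (y + 2 * (n%:R * pi)) = cos y.
  rewrite -[RHS](periodicn (@cosD2pi R) n); congr (cos (y + _)).
  by rewrite -[RHS]mulr_natr -[pi *+ 2]mulr_natr; ring.
case: k => n; first exact: cosD2npi.
by rewrite NegzE mulrNz -[LHS](cosD2npi n.+1); congr cos; rewrite pmulrn; ring.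
Qed.

Lemma sinD2kpi x (k : int) : sin (x + 2 * (k%:~R * pi)) = sin x.
Proof. by rewrite -!cosBpihalf addrAC cosD2kpi. Qed.

Lemma antipodal_lipschitz x y (k : int) :
  `|cos x + cos y| <= `|x - y + pi + 2 * (k%:~R * pi)| /\
  `|sin x + sin y| <= `|x - y + pi + 2 * (k%:~R * pi)|.
Proof.
have -> : x - y + pi + 2 * (k%:~R * pi) = (x + 2 * (k%:~R * pi)) - (y - pi) by ring.
have [cosy siny] : cos y = - cos (y - pi) /\ sin y = - sin (y - pi).
  by rewrite -{1 3}[y](subrK pi) cosDpi sinDpi.
rewrite cosy siny -(cosD2kpi x k) -(sinD2kpi x k).
by split; [exact: cos_lipschitz|exact: sin_lipschitz].
Qed.

Lemma pihalf_le_normD (k : int) : pi / 2 <= `|pi / 2 + k%:~R * pi| :> R.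
Proof.
have pi0 := pi_gt0 R; case: k => j; have j0 : 0 <= j%:R * pi :> R by rewrite mulr_ge0// ltW.
  by rewrite -pmulrn ger0_norm; lra.
have -> : pi / 2 + (Negz j)%:~R * pi = - (j%:R * pi + pi / 2) :> R.
  by rewrite NegzE mulrNz -pmulrn -natr1; field.
by rewrite normrN ger0_norm; lra.
Qed.

Lemma cos_eq1 x : cos x = 1 -> exists k : int, x = 2 * (k%:~R * pi).
Proof.
move=> cx; pose k := Num.floor ((x + pi) / (2 * pi)).
have pi0 := pi_gt0 R; have pi2 : 0 < 2 * pi :> R by lra.
have /andP[kx xk] : k%:~R <= (x + pi) / (2 * pi) < k%:~R + 1.
  by rewrite Num.Theory.floor_le// -intrD1 Num.Theory.lt_succ_floor.
rewrite ler_pdivlMr// in kx; rewrite ltr_pdivrMr// in xk.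
exists k; apply/eqP; rewrite -subr_eq0 -normr_eq0; apply/eqP.
apply: cos_inj.
- by rewrite in_itv/= normr_ge0 ler_norml; lra.
- by rewrite in_itv/= lexx ltW.
- by rewrite cos_norm -(cosD2kpi _ k) subrK cos0.
Qed.

End trigonometry.

Section hyperbolic_tangent.
Context {R : realType}.
Implicit Types x : R.

Lemma cosh_gt0 x : 0 < expR x + expR (- x).
Proof. by rewrite addr_gt0 ?expR_gt0. Qed.

Lemma is_derive_tanh x : is_derive x 1 (@tanh R) (1 - tanh x ^+ 2).
Proof.
have dN : is_derive x 1 (fun t : R => expR (- t)) (- expR (- x)).
  by apply: is_derive_eq; rewrite mulrN1.
have nz : expR x + expR (- x) != 0 by rewrite gt_eqF ?cosh_gt0.
have dV := @is_deriveV R (fun t => expR t + expR (- t)) x _ 1 nz (is_deriveD (is_derive_expR x) dN).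
have := is_deriveM (is_deriveB (is_derive_expR x) dN) dV.
move/is_derive_eq; apply.
by rewrite !fctE /tanh /GRing.scale/=; field.
Qed.

Lemma tanhN x : tanh (- x) = - tanh x.
Proof. by rewrite /tanh opprK -[RHS]mulNr opprB [in X in _ / X]addrC. Qed.

Lemma tanh0 : tanh 0 = 0 :> R.
Proof. by rewrite /tanh oppr0 subrr mul0r. Qed.

Lemma tanh_norm_lt1 x : `|tanh x| < 1.
Proof.
have := expR_gt0 x; have := expR_gt0 (- x); have := cosh_gt0 x.
by rewrite ltr_norml /tanh => c0; rewrite ltr_pdivlMr// ltr_pdivrMr//; lra.
Qed.

Lemma tanh_gt0 x : 0 < x -> 0 < tanh x.
Proof. by move=> x0; rewrite divr_gt0 ?cosh_gt0// subr_gt0 ltr_expR; lra. Qed.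

Lemma onem_tanh_le x : 0 <= x -> 1 - tanh x <= 2 * expR (- x).
Proof.
move=> x0; have := expR_gt0 (- x); have := expR_ge1Dx x => ex enx.
have -> : 1 - tanh x = 2 * expR (- x) / (expR x + expR (- x)).
  by rewrite /tanh; field; rewrite gt_eqF ?cosh_gt0.
by rewrite ler_pdivrMr ?cosh_gt0// ler_peMr//; lra.
Qed.

End hyperbolic_tangent.

Section square_root_of_two.
Context {R : realType}.

Lemma sqrt2_sqr : Num.sqrt 2 ^+ 2 = 2 :> R.
Proof. by rewrite sqr_sqrtr. Qed.

Lemma sqrt2_gt0 : 0 < Num.sqrt 2 :> R.
Proof. by rewrite sqrtr_gt0. Qed.

Lemma sqrt2_ge1 : 1 <= Num.sqrt 2 :> R.
Proof. by rewrite -[leLHS]sqrtr1 ler_wsqrtr// ler1n. Qed.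

Lemma div_sqrt2 : 2 / Num.sqrt 2 = Num.sqrt 2 :> R.
Proof. by apply: (canLR (mulfK (lt0r_neq0 sqrt2_gt0))); rewrite -expr2 sqrt2_sqr. Qed.

Lemma sqrt2_le2 : Num.sqrt 2 <= 2 :> R.
Proof. by rewrite -div_sqrt2 ler_pdivrMr ?sqrt2_gt0// ler_peMr// sqrt2_ge1. Qed.

End square_root_of_two.

Section kink_profile.
Context {R : realType}.
Implicit Types x : R.
Notation kink := (@kink R).
Notation s2 := (Num.sqrt 2 : R).

Definition kink' x : R := (1 - kink x ^+ 2) / s2.

Lemma is_derive_kink x : is_derive x 1 kink (kink' x).
Proof.
have dS : is_derive x 1 (fun t : R => t / s2) s2^-1.
  by apply: is_derive_eq; rewrite !scaler0 add0r /GRing.scale/= mulr1.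
have dT := is_derive_tanh (x / s2).
exact: (is_derive1_comp (f := @tanh R) (g := fun t : R => t / s2)).
Qed.

Lemma derive1_kink x : derive1 kink x = kink' x.
Proof. by rewrite derive1E; have [_ ->] := is_derive_kink x. Qed.

Lemma prim_kink : is_prim kink kink'.
Proof.
have ck : continuous kink.
  by move=> x; apply/differentiable_continuous/derivable1_diffP; have [] := is_derive_kink x.
by apply: prim_derive; [exact: is_derive_kink|rewrite /kink'; continuity].
Qed.

Lemma prim_kink' : is_prim kink' (fun t => - (s2 * kink t * kink' t)).
Proof.
have := primZ s2^-1 (primB (prim_cst 1) (prim_sqr prim_kink)).
move=> /eq_prim; apply => t; first by rewrite /kink' mulrC.
by rewrite sub0r mulrN !mulrA [_^-1 * 2]mulrC div_sqrt2.
Qed.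

Lemma continuous_kink : continuous kink. Proof. exact: prim_continuous prim_kink. Qed.

Lemma continuous_kink' : continuous kink'. Proof. exact: prim_continuous prim_kink'. Qed.

Lemma kinkN x : kink (- x) = - kink x.
Proof. by rewrite /kink mulNr tanhN. Qed.

Lemma kink0 : kink 0 = 0.
Proof. by rewrite /kink mul0r tanh0. Qed.

Lemma kink_norm_lt1 x : `|kink x| < 1.
Proof. exact: tanh_norm_lt1. Qed.

Lemma kink_gt0 x : 0 < x -> 0 < kink x.
Proof. by move=> x0; rewrite tanh_gt0// divr_gt0// sqrt2_gt0. Qed.

Lemma kink_ge0 x : 0 <= x -> 0 <= kink x.
Proof. by rewrite le_eqVlt => /predU1P[<-|/kink_gt0/ltW//]; rewrite kink0. Qed.

Lemma kink'_gt0 x : 0 < kink' x.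
Proof.
have := kink_norm_lt1 x; rewrite ltr_norml => k1.
by rewrite divr_gt0 ?sqrt2_gt0//; nra.
Qed.

Lemma kink'_le1 x : kink' x <= 1.
Proof.
rewrite ler_pdivrMr ?sqrt2_gt0// mul1r; apply: le_trans sqrt2_ge1.
by rewrite lerBlDr lerDl sqr_ge0.
Qed.

Lemma kink_le x : 0 <= x -> kink x <= x.
Proof.
move=> x0; have := primE prim_kink x0; rewrite kink0 subr0 => <-.
rewrite -[leRHS]subr0 -[leRHS]mul1r -Int_cst//; apply: le_Int.
- exact: prim_locint prim_kink.
- exact: locint_cst.
- by move=> t _; exact: kink'_le1.
Qed.

Lemma near_onem_kink_le e : 0 < e -> \forall x \near +oo, 1 - kink x <= e.
Proof.
move=> e0; have e2 : 0 < e / 2 by lra.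
have /cvgr0_norm_le/(_ _ e2) [M [_ expM]] := @cvgr_expR R.
near=> x; have x0 : 0 <= x / s2.
  by rewrite divr_ge0 ?(ltW sqrt2_gt0)//; near: x; exact: nbhs_pinfty_ge.
have : `|expR (- (x / s2))| <= e / 2.
  by apply: expM; rewrite ltr_pdivlMr ?sqrt2_gt0//; near: x; apply: nbhs_pinfty_gt; exact: num_real.
by have := onem_tanh_le x0; rewrite ger0_norm ?expR_ge0// -/(kink x); lra.
Unshelve. all: by end_near. Qed.

End kink_profile.

Record wave (R : realType) :=
  Wave { re : R -> R; im : R -> R; re' : R -> R; im' : R -> R }.

Section waves.
Context {R : realType}.
Implicit Types (v : wave R) (x y t c E alpha : R).

Definition modsq v t := re v t ^+ 2 + im v t ^+ 2.

Definition modulus v t := Num.sqrt (modsq v t).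

Definition speedsq v t := re' v t ^+ 2 + im' v t ^+ 2.

Definition radial v t := re v t * re' v t + im v t * im' v t.

Definition current v := momentum_density (re v) (im v) (re' v) (im' v).

Definition energy_density v t := 2^-1 * speedsq v t + 4^-1 * (1 - modsq v t) ^+ 2.

Definition H1loc v :=
  [/\ is_prim (re v) (re' v), is_prim (im v) (im' v) & locint (speedsq v)].

Definition energy_le v E := forall x y, x <= y -> Int x y (energy_density v) <= E.

Definition is_arg v t alpha :=
  [/\ 0 < modsq v t, re v t = modulus v t * cos alpha & im v t = modulus v t * sin alpha].

(* The derivative of the argument of [v] where [c <= |v|^2]; the truncation makes it
   locally integrable even if [v] vanishes elsewhere. *)
Definition arg_rate v c t := (Num.max c (modsq v t))^-1 * current v t.

Lemma modsq_ge0 v t : 0 <= modsq v t.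
Proof. by rewrite addr_ge0 ?sqr_ge0. Qed.

Lemma speedsq_ge0 v t : 0 <= speedsq v t.
Proof. by rewrite addr_ge0 ?sqr_ge0. Qed.

Lemma modulus_ge0 v t : 0 <= modulus v t.
Proof. exact: sqrtr_ge0. Qed.

Lemma modulus_sqr v t : modulus v t ^+ 2 = modsq v t.
Proof. by rewrite sqr_sqrtr ?modsq_ge0. Qed.

Lemma energy_density_ge0 v t : 0 <= energy_density v t.
Proof. by rewrite addr_ge0// mulr_ge0 ?speedsq_ge0 ?sqr_ge0. Qed.

Lemma potential_le_energy_density v t : (1 - modsq v t) ^+ 2 <= 4 * energy_density v t.
Proof. by rewrite /energy_density; have := speedsq_ge0 v t; lra. Qed.

Lemma modsq_mul_speedsq v t :
  modsq v t * speedsq v t = radial v t ^+ 2 + current v t ^+ 2.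
Proof. by rewrite /modsq /speedsq /radial /current /momentum_density; ring. Qed.

Lemma is_arg_polar v t m alpha : 0 < m ->
  re v t = m * cos alpha -> im v t = m * sin alpha -> is_arg v t alpha.
Proof.
move=> m0 reE imE; have modE : modsq v t = m ^+ 2.
  by rewrite /modsq reE imE !exprMn -mulrDr cos2Dsin2 mulr1.
by split; rewrite ?/modulus modE ?exprn_gt0// sqrtr_sqr gtr0_norm.
Qed.

Lemma exists_arg v t : 0 < modsq v t -> exists2 alpha, `|alpha| <= pi & is_arg v t alpha.
Proof.
move=> n0; have m0 : 0 < modulus v t by rewrite sqrtr_gt0.
have [|alpha alpha_pi [ca sa]] := @exists_angle R (re v t / modulus v t) (im v t / modulus v t).
  by rewrite !expr_div_n -mulrDl modulus_sqr divff ?gt_eqF.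
by exists alpha => //; apply: (is_arg_polar m0); rewrite ?ca ?sa mulrC divfK ?gt_eqF.
Qed.

Lemma is_arg_unique v t alpha beta : is_arg v t alpha -> is_arg v t beta ->
  cos alpha = cos beta /\ sin alpha = sin beta.
Proof.
move=> [n0 ca sa] [_ cb sb]; have m0 : modulus v t != 0 by rewrite gt_eqF// sqrtr_gt0.
by split; apply: (mulfI m0); rewrite -?ca -?sa.
Qed.

Lemma eq_is_arg v t alpha beta : cos alpha = cos beta -> sin alpha = sin beta ->
  is_arg v t alpha -> is_arg v t beta.
Proof. by rewrite /is_arg => -> ->. Qed.

Section local_regularity.
Variable v : wave R.
Hypothesis Hv : H1loc v.

Let lre' : locint (re' v). Proof. by case: Hv => /prim_locint. Qed.
Let lim' : locint (im' v). Proof. by case: Hv => _ /prim_locint. Qed.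
Let cre : continuous (re v). Proof. by case: Hv => /prim_continuous. Qed.
Let cim : continuous (im v). Proof. by case: Hv => _ /prim_continuous. Qed.

Lemma prim_modsq : is_prim (modsq v) (fun t => 2 * radial v t).
Proof.
case: Hv => pre pim _; apply: (eq_prim (primD (prim_sqr pre) (prim_sqr pim))) => // t.
by rewrite /radial; ring.
Qed.

Lemma continuous_modsq : continuous (modsq v).
Proof. exact: prim_continuous prim_modsq. Qed.

Lemma locint_radial : locint (radial v).
Proof. exact: locintD (locintM cre lre') (locintM cim lim'). Qed.

Lemma locint_current : locint (current v).
Proof. exact: locintB (locintM cre lim') (locintM cim lre'). Qed.

Lemma locint_energy_density : locint (energy_density v).
Proof.
have cn := continuous_modsq; case: Hv => _ _ lv'.
by apply: locintD; [exact: locintZ|apply: continuous_locint; continuity].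
Qed.

Lemma continuous_truncV c : 0 < c -> continuous (fun t => (Num.max c (modsq v t))^-1).
Proof.
move=> c0 t; apply: cvgV; first by rewrite gt_eqF// lt_max c0.
by apply: continuous_max; [exact: cvg_cst|exact: continuous_modsq].
Qed.

Lemma locint_arg_rate c : 0 < c -> locint (arg_rate v c).
Proof. by move=> c0; apply: locintM locint_current; exact: continuous_truncV. Qed.

(* Turned backwards by the angle [alpha + int_x^t arg_rate], [v] solves a real
   linear equation, hence keeps the direction that it has at [x]. *)
Lemma is_arg_lift c x y alpha : 0 < c -> x <= y -> (forall t, x <= t <= y -> c <= modsq v t) ->
  is_arg v x alpha -> is_arg v y (alpha + Int x y (arg_rate v c)).
Proof.
move=> c0 xy cv [nx rex imx]; case: Hv => pre pim _.
have [theta ptheta thx] := exists_prim x alpha (locint_arg_rate c0).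
have -> : alpha + Int x y (arg_rate v c) = theta y by rewrite (primE ptheta xy) thx; ring.
have [pcos psin] := (prim_cos ptheta, prim_sin ptheta).
have lg := locintM (continuous_truncV c0) locint_radial.
have growth f f' : is_prim f f' ->
    (forall t, Num.max c (modsq v t) = modsq v t -> modsq v t != 0 ->
       f' t = (Num.max c (modsq v t))^-1 * radial v t * f t) ->
    exists2 m, 0 < m & f y = m * f x.
  move=> pf f'E; exists (expR (Int x y (fun t => (Num.max c (modsq v t))^-1 * radial v t))).
    exact: expR_gt0.
  rewrite mulrC; apply: linear_ode_sol pf lg xy _ => t /cv cn.
  by rewrite f'E// ?max_r// gt_eqF// (lt_le_trans c0).
have [t nE n0|m m0 /= along] := growth _ _ (primD (primM pre pcos) (primM pim psin)).
  rewrite /arg_rate nE /radial /current /momentum_density /=.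
  by move: n0; rewrite /modsq => n0; field.
have {}along : re v y * cos (theta y) + im v y * sin (theta y) = m * modulus v x.
  by rewrite along /= thx rex imx -[RHS]mulr1 -(cos2Dsin2 alpha); ring.
have [t nE n0|m' _ /= across] := growth _ _ (primB (primM pim pcos) (primM pre psin)).
  rewrite /arg_rate nE /radial /current /momentum_density /=.
  by move: n0; rewrite /modsq => n0; field.
have {}across : im v y * cos (theta y) - re v y * sin (theta y) = 0.
  by rewrite across /= thx rex imx; ring.
have cs := cos2Dsin2 (theta y).
apply: (@is_arg_polar v y (m * modulus v x)); first by rewrite mulr_gt0// sqrtr_gt0.
- by rewrite -along -[LHS]mul1r -cs -[RHS]subr0 -(mul0r (sin (theta y))) -across; ring.
- by rewrite -along -[LHS]mul1r -cs -[RHS]addr0 -(mul0r (cos (theta y))) -across; ring.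
Qed.

Lemma is_arg_lift_left c x y beta : 0 < c -> x <= y ->
  (forall t, x <= t <= y -> c <= modsq v t) ->
  is_arg v y beta -> is_arg v x (beta - Int x y (arg_rate v c)).
Proof.
move=> c0 xy cv vy; set A := Int x y _.
have [|alpha _ vx] := @exists_arg v x; first by rewrite (lt_le_trans c0)// cv ?lexx.
have [cosE sinE] := is_arg_unique (is_arg_lift c0 xy cv vx) vy.
rewrite -/A in cosE sinE; apply: eq_is_arg vx.
  by rewrite -[alpha](addrK A) !cosB cosE sinE.
by rewrite -[alpha](addrK A) !sinB cosE sinE.
Qed.

End local_regularity.

End waves.

Section symmetries.
Context {R : realType}.
Implicit Types (v : wave R) (x y c t d E eps alpha : R).

Definition reflect v :=
  Wave (fun t => re v (- t)) (fun t => im v (- t))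
    (fun t => - re' v (- t)) (fun t => - im' v (- t)).

Definition translate c v :=
  Wave (fun t => re v (t + c)) (fun t => im v (t + c))
    (fun t => re' v (t + c)) (fun t => im' v (t + c)).

Lemma speedsq_reflect v t : speedsq (reflect v) t = speedsq v (- t).
Proof. by rewrite /speedsq !sqrrN. Qed.

Lemma current_reflect v t : current (reflect v) t = - current v (- t).
Proof. by rewrite /current /momentum_density /=; ring. Qed.

Lemma energy_density_reflect v t : energy_density (reflect v) t = energy_density v (- t).
Proof. by rewrite /energy_density speedsq_reflect. Qed.

Lemma modsq_reflect v t : modsq (reflect v) t = modsq v (- t).
Proof. by []. Qed.

Lemma modsq_translate c v t : modsq (translate c v) t = modsq v (t + c).
Proof. by []. Qed.

Lemma is_arg_reflect v t alpha : is_arg (reflect v) t alpha = is_arg v (- t) alpha.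
Proof. by []. Qed.

Lemma is_arg_translate c v t alpha : is_arg (translate c v) t alpha = is_arg v (t + c) alpha.
Proof. by []. Qed.

Lemma H1loc_reflect v : H1loc v -> H1loc (reflect v).
Proof.
move=> [pre pim lv']; split; [exact: prim_reflect|exact: prim_reflect|].
by rewrite (funext (speedsq_reflect v)); exact: locint_reflect.
Qed.

Lemma H1loc_translate c v : H1loc v -> H1loc (translate c v).
Proof.
move=> [pre pim lv']; split; [exact: prim_translate|exact: prim_translate|].
exact: (locint_translate c lv').
Qed.

Lemma Int_current_reflect v x y : H1loc v ->
  Int x y (current (reflect v)) = - Int (- y) (- x) (current v).
Proof.
move=> Hv; have lw := locint_current Hv.
rewrite -Int_reflect// -mulN1r -IntZ; last exact: locint_reflect.
by apply: eq_Int => t _; rewrite current_reflect mulN1r.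
Qed.

Lemma energy_le_reflect v E : H1loc v -> energy_le v E -> energy_le (reflect v) E.
Proof.
move=> Hv vE x y xy; rewrite (eq_Int (fun t _ => energy_density_reflect v t)).
by rewrite Int_reflect; [apply: vE; rewrite lerN2|exact: locint_energy_density].
Qed.

Lemma energy_le_translate c v E : H1loc v -> energy_le v E -> energy_le (translate c v) E.
Proof.
move=> Hv vE x y xy; have := Int_translate c x y (locint_energy_density Hv).
by move=> ->; apply: vE; rewrite lerD2r.
Qed.

(* Unlike [momentum_is], this does not refer to symmetric intervals, hence is
   invariant under translations. *)
Definition momentum_near_pi2 v eps := forall r eta : R, 0 < eta ->
  exists x y, [/\ x <= - r, r <= y, `|1 - modsq v x| < eta, `|1 - modsq v y| < eta &
    forall alpha beta, is_arg v x alpha -> is_arg v y beta -> exists k : int,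
      `|2^-1 * Int x y (current v) - 2^-1 * (beta - alpha) - pi / 2 - k%:~R * pi| < eps].

Lemma momentum_near_pi2_reflect v eps : H1loc v ->
  momentum_near_pi2 v eps -> momentum_near_pi2 (reflect v) eps.
Proof.
move=> Hv vp r eta eta0; have [x [y [xr ry nx ny arg_xy]]] := vp r eta eta0.
exists (- y), (- x); split; rewrite ?lerN2 1?lerNr//.
1,2: by rewrite modsq_reflect opprK.
move=> beta alpha; rewrite !is_arg_reflect !opprK => vy vx.
have [k kE] := arg_xy _ _ vx vy; exists (- k - 1).
rewrite Int_current_reflect// !opprK intrB mulrNz -normrN.
by congr (`|_| < _): kE; field.
Qed.

Lemma momentum_near_pi2_translate c v eps : H1loc v ->
  momentum_near_pi2 v eps -> momentum_near_pi2 (translate c v) eps.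
Proof.
move=> Hv vp r eta eta0; have [x [y [xr ry nx ny arg_xy]]] := vp (r + `|c|) eta eta0.
have cb : - `|c| <= c <= `|c| by rewrite -ler_norml.
exists (x - c), (y - c); split; try by [lra|rewrite modsq_translate subrK].
move=> alpha beta; rewrite !is_arg_translate !subrK => vx vy.
have -> : Int (x - c) (y - c) (current (translate c v)) = Int x y (current v).
  by rewrite (Int_translate c (x - c) (y - c) (locint_current Hv)) !subrK.
exact: arg_xy.
Qed.

Definition kink_energy : R := Num.sqrt 2 * (2 / 3).

Definition almost_kink v d :=
  [/\ H1loc v, modsq v 0 <= d ^+ 2, energy_le v (kink_energy + d) & momentum_near_pi2 v d].

Lemma almost_kink_reflect v d : almost_kink v d -> almost_kink (reflect v) d.
Proof.
move=> [Hv v0 vE vp]; split.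
- exact: H1loc_reflect.
- by rewrite modsq_reflect oppr0.
- exact: energy_le_reflect.
- exact: momentum_near_pi2_reflect.
Qed.

End symmetries.

Section calibration_function.
Context {R : realType}.
Variable m : R.
Hypothesis m_gt0 : 0 < m.

(* With [s^2 + m^2 = |v|^2], the derivative is [s^2 (1 - |v|^2) / |v|^2]. *)
Definition calib (s : R) := s - m * atan (s / m) - s ^+ 3 / 3.

Let calib' (s : R) := 1 - m ^+ 2 / (m ^+ 2 + s ^+ 2) - s ^+ 2.

Let denom_gt0 s : 0 < m ^+ 2 + s ^+ 2.
Proof. by rewrite ltr_pwDl ?exprn_gt0 ?sqr_ge0. Qed.

Lemma prim_calib f f' : is_prim f f' -> is_prim (calib \o f) (fun t => calib' (f t) * f' t).
Proof.
move=> pf; apply: prim_comp pf _ _ => t; move: (f t) => s; last first.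
  apply: cvgB; last by apply: exprn_continuous.
  apply: cvgB; first exact: cvg_cst.
  apply: cvgM; first exact: cvg_cst.
  apply: cvgV; first by rewrite gt_eqF ?denom_gt0.
  by apply: cvgD; [exact: cvg_cst|exact: exprn_continuous].
have datan : is_derive s 1 (fun r : R => m * atan (r / m)) (m * ((1 + (s / m) ^+ 2)^-1 * m^-1)).
  suff : is_derive s 1 (fun r : R => atan (r / m)) ((1 + (s / m) ^+ 2)^-1 * m^-1).
    by move=> ?; apply: is_derive_eq.
  apply: (is_derive1_comp (f := atan) (g := fun r => r / m)).
  by apply: is_derive_eq; rewrite !scaler0 add0r /GRing.scale/= mulr1.
have dcube : is_derive s 1 (fun r : R => r ^+ 3 / 3) (s ^+ 2).
  by apply: is_derive_eq; rewrite !scaler0 add0r /GRing.scale/= mulr1; field.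
have := is_deriveB (is_deriveB (is_derive_id s (1 : R)) datan) dcube.
move/is_derive_eq; apply; congr (1 - _ - _).
by field; rewrite !gt_eqF ?denom_gt0.
Qed.

Lemma calib_le s : 0 <= s -> calib s <= s.
Proof.
move=> s0; have : 0 <= m * atan (s / m).
  by rewrite mulr_ge0 ?(ltW m_gt0)// -atan0 le_atan// divr_ge0// ltW.
by have := exprn_ge0 3 s0; rewrite /calib; lra.
Qed.

Lemma near1_calib_ge eta : 0 < eta -> \forall s \near (1 : R),
  calib (Num.sqrt (1 - m ^+ 2)) - eta <= calib (Num.sqrt (s - m ^+ 2)).
Proof.
move=> eta0; have ccalib : continuous calib := prim_continuous (prim_calib (@prim_id R)).
have sqrt_cvg : (fun s => Num.sqrt (s - m ^+ 2)) s @[s --> (1 : R)] --> Num.sqrt (1 - m ^+ 2).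
  apply: continuous_comp; last exact: sqrt_continuous.
  by apply: cvgB; [exact: cvg_id|exact: cvg_cst].
have /cvgrPdist_lt/(_ _ eta0) := cvg_comp _ _ sqrt_cvg (ccalib _).
by apply: filterS => s /=; rewrite ltr_norml; lra.
Qed.

Hypothesis m_lt1 : m < 1.

Lemma atan_sqrt_onem_sqr_le : atan (Num.sqrt (1 - m ^+ 2) / m) <= pi / 2 - m.
Proof.
have [m0 m1] := (m_gt0, m_lt1).
have pi1 := pihalf_ge1 R.
have sm0 : 0 < sin m by apply: sin_gt0_pihalf; lra.
have cm0 : 0 < cos m by apply: cos_gt0_pihalf; lra.
have smm : sin m <= m.
  by have := sin_lipschitz m 0; rewrite sin0 !subr0 !gtr0_norm.
have scm : Num.sqrt (1 - m ^+ 2) <= cos m.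
  rewrite -(ger0_norm (ltW cm0)) -sqrtr_sqr ler_wsqrtr// cos2sin2.
  by rewrite lerD2l lerN2 ler_pXn2r ?nnegrE ?(ltW sm0) ?(ltW m0).
rewrite -[leRHS](@tanK R); last by rewrite in_itv/=; lra.
apply: le_atan; rewrite /tan -[cos (_ - _)]cosN -[sin (_ - _)]opprK -sinN opprB.
rewrite cosBpihalf sinBpihalf opprK ler_pdivlMr// mulrAC ler_pdivrMr//.
by nra.
Qed.

Lemma calib_sqrt_onem_sqr_ge :
  2 / 3 + m ^+ 2 / 6 <= m * (pi / 2) + calib (Num.sqrt (1 - m ^+ 2)).
Proof.
have := atan_sqrt_onem_sqr_le; rewrite -(ler_pM2l m_gt0) /calib.
have := sqrtr_ge0 (1 - m ^+ 2); have : Num.sqrt (1 - m ^+ 2) ^+ 2 = 1 - m ^+ 2.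
  by rewrite sqr_sqrtr// subr_ge0 exprn_ile1 ?ltW.
move: (Num.sqrt _) (m * atan _) => s A s2 s0 mA.
have s1 : s <= 1.
  by rewrite -ler_sqr ?nnegrE// expr1n s2 lerBlDr lerDl sqr_ge0.
have : 0 <= (1 - s) * (1 + 7 * s + 2 * s ^+ 2).
  by rewrite mulr_ge0 ?subr_ge0//; have := sqr_ge0 s; lra.
by lra.
Qed.

End calibration_function.

Section calibrated_energy.
Context {R : realType}.
Variable v : wave R.
Hypothesis Hv : H1loc v.
Notation n := (modsq v).
Notation s2 := (Num.sqrt 2 : R).

Lemma calibration_le_energy_density t m q : 0 < n t -> m ^+ 2 + q ^+ 2 = n t ->
  s2 / 2 * (m * `|(1 - n t) / n t * current v t| + q * `|(1 - n t) / n t * radial v t|)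
  <= energy_density v t.
Proof.
move=> n0 mq; rewrite -subr_ge0 -(pmulr_rge0 _ (_ : 0 < 2 * n t)) ?mulr_gt0//.
rewrite !normrM normfV (gtr0_norm n0).
set P := `|1 - n t|; set w := `|current v t|; set u := `|radial v t|.
have -> : 2 * n t * (energy_density v t - s2 / 2 * (m * (P / n t * w) + q * (P / n t * u))) =
    (w - m * P * s2 / 2) ^+ 2 + (u - q * P * s2 / 2) ^+ 2 + n t * P ^+ 2 / 4 * (2 - s2 ^+ 2).
  transitivity (n t * speedsq v t + n t * P ^+ 2 / 2 - s2 * P * (m * w + q * u)).
    by rewrite /energy_density /P real_normK ?num_real//; field; rewrite gt_eqF.
  rewrite modsq_mul_speedsq -(real_normK (num_real (radial v t))).
  by rewrite -(real_normK (num_real (current v t))) -/w -/u -mq; field.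
by rewrite sqrt2_sqr subrr mulr0 addr0 addr_ge0 ?sqr_ge0.
Qed.

Section modulus_bounded_below.
Variable m : R.
Hypotheses (m_gt0 : 0 < m) (m_lt : forall t, m ^+ 2 < n t).

Let q t := Num.sqrt (n t - m ^+ 2).
Let n_gt0 t : 0 < n t. Proof. exact: le_lt_trans (sqr_ge0 m) (m_lt t). Qed.
Let q_gt0 t : 0 < q t. Proof. by rewrite sqrtr_gt0 subr_gt0. Qed.
Let q_sqr t : q t ^+ 2 = n t - m ^+ 2. Proof. by rewrite sqr_sqrtr// subr_ge0 ltW. Qed.

Lemma prim_calib_modsq :
  is_prim (fun t => calib m (q t)) (fun t => q t * ((1 - n t) / n t * radial v t)).
Proof.
have f0 t : 0 < n t - m ^+ 2 by rewrite subr_gt0.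
have pq := prim_sqrt (primB (prim_modsq Hv) (prim_cst (m ^+ 2))) f0.
apply: (eq_prim (prim_calib m_gt0 pq)) => // t; rewrite -/(q t) q_sqr subr0.
have -> : m ^+ 2 = n t - q t ^+ 2 by rewrite q_sqr; ring.
by field; rewrite !gt_eqF//= addrC subrK gt_eqF ?n_gt0.
Qed.

Lemma arg_rateB_current t :
  arg_rate v (m ^+ 2) t - current v t = (1 - n t) / n t * current v t.
Proof. by rewrite /arg_rate max_r ?ltW//; field; rewrite gt_eqF ?n_gt0. Qed.

Lemma calibration_le_Int_energy_density x x0 y : x <= x0 -> x0 <= y ->
  s2 / 2 * (m * `|Int x y (arg_rate v (m ^+ 2)) - Int x y (current v)|
    + (calib m (q x) + calib m (q y) - 2 * calib m (q x0))) <= Int x y (energy_density v).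
Proof.
move=> xx0 x0y; have mm : 0 < m ^+ 2 by rewrite exprn_gt0.
have lw := locint_current Hv; have lr := locint_arg_rate Hv mm.
have lW := locintB lr lw; have lC := prim_locint prim_calib_modsq.
have lWn := locint_norm lW; have lCn := locint_norm lC; have lmW := locintZ m lWn.
apply: (@le_trans _ _ (Int x y (fun t => s2 / 2 * (m * `|arg_rate v (m ^+ 2) t - current v t|
    + `|q t * ((1 - n t) / n t * radial v t)|)))); last first.
  apply: le_Int => [||t _]; [exact/locintZ/locintD|exact: locint_energy_density|].
  rewrite arg_rateB_current (normrM (q t)) (gtr0_norm (q_gt0 t)).
  by apply: calibration_le_energy_density => //; rewrite q_sqr; ring.
rewrite (IntZ _ _ (s2 / 2) (locintD lmW lCn)).
rewrite ler_pM2l ?divr_gt0 ?sqrt2_gt0// (IntD _ _ lmW lCn) (IntZ _ _ m lWn) -IntB//; apply: lerD.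
  by rewrite ler_pM2l//; exact: Int_norm.
rewrite (Int_cat lCn xx0 x0y).
have /lerNnormlW := Int_norm x x0 lC; have /ler_normlW := Int_norm x0 y lC.
by rewrite !(primE prim_calib_modsq)//; lra.
Qed.

End modulus_bounded_below.
End calibrated_energy.

Section vanishing_modulus.
Context {R : realType}.
Variable v : wave R.
Hypothesis Hv : H1loc v.
Notation n := (modsq v).

(* The difference of the two integrals is minus twice the momentum of [v] on [[x, y]]. *)
Lemma arg_rateB_current_ge c eps r eta : 0 < c -> (forall t, c <= n t) ->
  momentum_near_pi2 v eps -> 0 < eta ->
  exists x y, [/\ x <= - r, r <= y, `|1 - n x| < eta, `|1 - n y| < eta &
    pi - 2 * eps <= `|Int x y (arg_rate v c) - Int x y (current v)|].
Proof.
move=> c0 cn vp eta0.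
have [x [y [xr ry nx ny arg_xy]]] := vp (Num.max r 0) eta eta0.
move: xr ry; rewrite lerNr !ge_max oppr_ge0 => /andP[xr x0] /andP[ry y0].
exists x, y; split => //; first by rewrite lerNr.
have xy := le_trans x0 y0.
have [alpha _ vx] := exists_arg (lt_le_trans c0 (cn x)).
have vy := is_arg_lift Hv c0 xy (fun t _ => cn t) vx.
have [k] := arg_xy _ _ vx vy; rewrite [alpha + _]addrC addrK.
set A := Int x y (arg_rate v c); set B := Int x y (current v).
pose X := (A - B) / 2; pose Y : R := pi / 2 + k%:~R * pi.
have -> : 2^-1 * B - 2^-1 * A - pi / 2 - k%:~R * pi = - (X + Y) by rewrite /X /Y; field.
have -> : `|A - B| = 2 * `|X| by rewrite normrM [`|2^-1|]gtr0_norm//; field.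
have : pi / 2 <= `|Y| := pihalf_le_normD k.
have : `|Y| <= `|X + Y| + `|X| by rewrite -[Y in leLHS](addrK X) [Y + X]addrC ler_normB.
by rewrite normrN; lra.
Qed.

Lemma sqr_lower_bound_le m x0 eps : 0 < m -> m < 1 -> (forall t, m ^+ 2 < n t) -> 0 <= eps ->
  energy_le v (kink_energy + eps) -> momentum_near_pi2 v eps ->
  m ^+ 2 / 6 <= 2 * eps + Num.sqrt (n x0 - m ^+ 2).
Proof.
move=> m0 m1 mn eps0 vE vp; apply/ler_addgt0Pr => eta eta0.
have mm : 0 < m ^+ 2 by rewrite exprn_gt0.
have [d /= d0 calib_d] := near1_calib_ge m0 eta0.
have [x [y [xx0 x0y /calib_d Cx /calib_d Cy]]] :=
  arg_rateB_current_ge `|x0| mm (fun t => ltW (mn t)) vp d0.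
have x0b : - `|x0| <= x0 <= `|x0| by rewrite -ler_norml.
set W := `|_ - _| => W_ge.
have {xx0 x0y} [xx0 x0y] : x <= x0 /\ x0 <= y by lra.
have := le_trans (calibration_le_Int_energy_density Hv m0 mn xx0 x0y) (vE x y (le_trans xx0 x0y)).
rewrite -/W -ler_pdivlMl ?divr_gt0 ?sqrt2_gt0//.
have -> : (Num.sqrt 2 / 2)^-1 * (kink_energy + eps) = 4 / 3 + 2 / Num.sqrt 2 * eps :> R.
  by rewrite /kink_energy; field; rewrite gt_eqF ?sqrt2_gt0.
have := calib_sqrt_onem_sqr_ge m0 m1; have := calib_le m0 (sqrtr_ge0 (n x0 - m ^+ 2)).
have : m * (pi - 2 * eps) <= m * W by rewrite ler_pM2l.
have : 2 / Num.sqrt 2 * eps <= 2 * eps by rewrite ler_wpM2r// div_sqrt2 sqrt2_le2.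
have : m * eps <= eps by rewrite ler_piMl// ltW.
by lra.
Qed.

Lemma inf_modsq_le eps : 0 <= eps -> energy_le v (kink_energy + eps) ->
  momentum_near_pi2 v eps -> inf (range n) <= 25 * eps.
Proof.
move=> eps0 vE vp; set i := inf _.
have hi : has_inf (range n).
  by split; [exists (n 0), 0|exists 0 => _ [t _ <-]; exact: modsq_ge0].
have i_le t : i <= n t by apply: ge_inf; [case: hi|exists t].
have i1 : i <= 1.
  apply/ler_addgt0Pr => d d0; have [x [y [_ _ nx _ _]]] := vp 0 d d0.
  by apply: (le_trans (i_le x)); move: nx; rewrite ltr_norml; lra.
have [i0|i0] := leP i 0; first by apply: le_trans i0 _; rewrite mulr_ge0.
(* Apply the bound with [m^2] slightly below the infimum. *)
pose k := i / 24; have k2 : k ^+ 2 <= i / 576.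
  have : i ^+ 2 <= i by rewrite expr2 ger_pMl.
  by rewrite /k; lra.
have k0 : 0 < k ^+ 2 by rewrite exprn_gt0// divr_gt0.
have [_ [x0 _ <-] nx0] := inf_adherent k0 hi.
pose m := Num.sqrt (i - k ^+ 2); have mE : m ^+ 2 = i - k ^+ 2 by rewrite sqr_sqrtr//; lra.
have m0 : 0 < m by rewrite sqrtr_gt0; lra.
have m1 : m < 1 by rewrite -(@ltr_pXn2r _ 2)// ?nnegrE ?(ltW m0)// mE expr1n; lra.
have nm t : m ^+ 2 < n t by rewrite mE; have := i_le t; lra.
have := sqr_lower_bound_le x0 m0 m1 nm eps0 vE vp; rewrite mE.
have : Num.sqrt (n x0 - (i - k ^+ 2)) <= 2 * k.
  have k_ge0 : 0 <= 2 * k by rewrite mulr_ge0// divr_ge0// ltW.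
  rewrite -(ger0_norm k_ge0) -sqrtr_sqr ler_wsqrtr//.
  by move: nx0; rewrite -/i; lra.
by rewrite /k in k2 *; lra.
Qed.

End vanishing_modulus.

Section bogomolny.
Context {R : realType}.
Implicit Types (v : wave R) (s t x y : R).
Variable k : R.
Hypothesis k_gt0 : 0 < k.
Notation s2 := (Num.sqrt 2 : R).

(* A smooth substitute for [|v|] near the zeros of [v]. *)
Definition rho v t := Num.sqrt (modsq v t + k ^+ 2).

Definition slope v t := (1 - modsq v t) / (s2 * rho v t).

Definition potential s := (1 + k ^+ 2) * s - s ^+ 3 / 3.

Definition defect v t := energy_density v t - slope v t * radial v t.

(* What [rho] lacks to satisfy the equation of the kink. *)
Definition rho_error v t := radial v t / rho v t - (1 - modsq v t) / s2.

Lemma rho_gt0 v t : 0 < rho v t.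
Proof. by rewrite sqrtr_gt0 ltr_wpDl ?modsq_ge0 ?exprn_gt0. Qed.

Lemma rho_sqr v t : rho v t ^+ 2 = modsq v t + k ^+ 2.
Proof. by rewrite sqr_sqrtr// addr_ge0 ?modsq_ge0 ?sqr_ge0. Qed.

Lemma modulus_le_rho v t : modulus v t <= rho v t.
Proof. by rewrite ler_wsqrtr// lerDl sqr_ge0. Qed.

Lemma rho_le_modulus v t : rho v t <= modulus v t + k.
Proof.
have m0 := modulus_ge0 v t; have r0 := rho_gt0 v t; have k0 := k_gt0.
rewrite -ler_sqr ?nnegrE ?addr_ge0 ?(ltW r0) ?(ltW k0)//.
by rewrite rho_sqr sqrrD modulus_sqr lerD2r lerDl mulrn_wge0// mulr_ge0// ltW.
Qed.

Lemma slope_mul_rho v t : slope v t * rho v t = (1 - modsq v t) / s2.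
Proof. by rewrite /slope; field; rewrite !gt_eqF ?sqrt2_gt0 ?rho_gt0. Qed.

Lemma defectE v t : defect v t =
  2^-1 * ((re' v t - slope v t * re v t) ^+ 2 + (im' v t - slope v t * im v t) ^+ 2
          + (slope v t * k) ^+ 2).
Proof.
have V_E : (1 - modsq v t) ^+ 2 = 2 * slope v t ^+ 2 * (modsq v t + k ^+ 2).
  by rewrite -rho_sqr -mulrA -exprMn slope_mul_rho expr_div_n sqrt2_sqr; field.
by rewrite /defect /energy_density V_E /modsq /speedsq /radial; field.
Qed.

Lemma defect_ge0 v t : 0 <= defect v t.
Proof. by rewrite defectE mulr_ge0// !addr_ge0 ?sqr_ge0. Qed.

Lemma rho_error_sqr_le_defect v t : rho_error v t ^+ 2 <= 2 * defect v t.
Proof.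
have r0 := rho_gt0 v t; have r2 := rho_sqr v t; rewrite defectE.
rewrite /rho_error -slope_mul_rho; move: (slope v t) => p.
have -> : radial v t / rho v t - p * rho v t =
    (re v t * (re' v t - p * re v t) + im v t * (im' v t - p * im v t) - k * (p * k)) / rho v t.
  rewrite /radial; apply: (mulIf (lt0r_neq0 r0)); rewrite mulrBl !divfK ?gt_eqF// -mulrA -expr2.
  by rewrite r2 /modsq; ring.
rewrite expr_div_n ler_pdivrMr ?exprn_gt0// r2 /modsq.
move: (re v t) (im v t) (re' v t - _) (im' v t - _) (p * k) => a b f g h.
rewrite -subr_ge0.
have -> : 2 * (2^-1 * (f ^+ 2 + g ^+ 2 + h ^+ 2)) * (a ^+ 2 + b ^+ 2 + k ^+ 2)
    - (a * f + b * g - k * h) ^+ 2 =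
    (a * g - b * f) ^+ 2 + (a * h + k * f) ^+ 2 + (b * h + k * g) ^+ 2 by field.
by rewrite !addr_ge0 ?sqr_ge0.
Qed.

Lemma current_sqr_le_defect v t : current v t ^+ 2 <= 2 * modsq v t * defect v t.
Proof.
rewrite defectE; move: (slope v t) => p.
have -> : current v t = re v t * (im' v t - p * im v t) - im v t * (re' v t - p * re v t).
  by rewrite /current /momentum_density; ring.
rewrite /modsq; move: (re v t) (im v t) (re' v t - _) (im' v t - _) (p * k) => a b f g h.
rewrite -subr_ge0.
have -> : 2 * (a ^+ 2 + b ^+ 2) * (2^-1 * (f ^+ 2 + g ^+ 2 + h ^+ 2)) - (a * g - b * f) ^+ 2 =
    (a * f + b * g) ^+ 2 + (a ^+ 2 + b ^+ 2) * h ^+ 2 by field.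
by rewrite addr_ge0 ?sqr_ge0// mulr_ge0 ?addr_ge0 ?sqr_ge0.
Qed.

Lemma arg_rate_sqr_le_defect v c t : 0 < c -> arg_rate v c t ^+ 2 <= 2 / c * defect v t.
Proof.
move=> c0; have d0 := defect_ge0 v t; rewrite /arg_rate; set m := Num.max c _.
have cm : c <= m by rewrite le_max lexx.
have nm : modsq v t <= m by rewrite le_max lexx orbT.
have m0 := lt_le_trans c0 cm.
rewrite mulrC expr_div_n ler_pdivrMr ?exprn_gt0//; apply: le_trans (current_sqr_le_defect v t) _.
have -> : 2 / c * defect v t * m ^+ 2 = 2 * m * defect v t * (m / c) by field; rewrite gt_eqF.
apply: (@le_trans _ _ (2 * m * defect v t)).
  by rewrite ler_wpM2r// ler_pM2l.
by rewrite ler_peMr ?mulr_ge0 ?(ltW m0)// ler_pdivlMr// mul1r.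
Qed.

Lemma arg_rateB_current_sqr_le_defect v c t : 0 < c -> c <= modsq v t ->
  (arg_rate v c t - current v t) ^+ 2 <= (8 / c * energy_density v t) * defect v t.
Proof.
move=> c0 cn; have n0 := lt_le_trans c0 cn.
have -> : arg_rate v c t - current v t = (1 - modsq v t) * arg_rate v c t.
  by rewrite /arg_rate max_r//; field; rewrite gt_eqF.
have -> : 8 / c * energy_density v t * defect v t = 4 * energy_density v t * (2 / c * defect v t).
  by field; rewrite gt_eqF.
rewrite exprMn ler_pM ?sqr_ge0//; first exact: potential_le_energy_density.
exact: arg_rate_sqr_le_defect.
Qed.

Section locally_H1.
Variable v : wave R.
Hypothesis Hv : H1loc v.

Lemma prim_rho : is_prim (rho v) (fun t => radial v t / rho v t).
Proof.
have n0 t : 0 < modsq v t + k ^+ 2 by rewrite ltr_wpDl ?modsq_ge0 ?exprn_gt0.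
apply: (eq_prim (prim_sqrt (primD (prim_modsq Hv) (prim_cst (k ^+ 2))) n0)) => // t.
by rewrite -/(rho v t) addr0; field; rewrite gt_eqF ?rho_gt0.
Qed.

Lemma locint_rho_error : locint (rho_error v).
Proof.
apply: locintB; first exact: prim_locint prim_rho.
by have cn := continuous_modsq Hv; apply: continuous_locint; continuity.
Qed.

Lemma locint_slope_radial : locint (fun t => slope v t * radial v t).
Proof.
apply: locintM (locint_radial Hv) => t; apply: cvgM.
  by apply: cvgB; [exact: cvg_cst|exact: continuous_modsq].
apply: cvgV; first by rewrite mulf_neq0 ?gt_eqF ?sqrt2_gt0 ?rho_gt0.
by apply: cvgM; [exact: cvg_cst|exact: prim_continuous prim_rho _].
Qed.

Lemma locint_defect : locint (defect v).
Proof. by apply: locintB locint_slope_radial; exact: locint_energy_density. Qed.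

Lemma prim_potential_rho :
  is_prim (fun t => potential (rho v t)) (fun t => s2 * (slope v t * radial v t)).
Proof.
have pr := prim_rho.
have := primB (primZ (1 + k ^+ 2) pr) (primZ 3^-1 (primM (prim_sqr pr) pr)).
move=> /eq_prim; apply => t; first by rewrite /potential; field.
have r0 := rho_gt0 v t.
have -> : s2 * (slope v t * radial v t) = (1 - modsq v t) * (radial v t / rho v t).
  rewrite -[1 - _](@divfK _ s2) ?gt_eqF ?sqrt2_gt0// -slope_mul_rho.
  by field; rewrite gt_eqF.
have -> : modsq v t = rho v t ^+ 2 - k ^+ 2 by rewrite rho_sqr; ring.
by field; rewrite gt_eqF.
Qed.

Lemma Int_defectE x y : x <= y -> Int x y (defect v) =
  Int x y (energy_density v) - (potential (rho v y) - potential (rho v x)) / s2.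
Proof.
move=> xy; have lS := locint_slope_radial.
rewrite (IntB _ _ (locint_energy_density Hv) lS); congr (_ - _).
by rewrite -(primE prim_potential_rho xy) IntZ// mulrAC mulfV ?mul1r// gt_eqF ?sqrt2_gt0.
Qed.

Lemma potential_rho_le x y : x <= y ->
  (potential (rho v y) - potential (rho v x)) / s2 <= Int x y (energy_density v).
Proof.
move=> xy; rewrite -subr_ge0 -Int_defectE//.
by apply: Int_ge0 => t _; exact: defect_ge0.
Qed.

End locally_H1.
End bogomolny.

Section potential_bounds.
Context {R : realType}.
Implicit Types (v : wave R) (k s t d : R).

Lemma kink_energyE : kink_energy = 4 / 3 / Num.sqrt 2 :> R.
Proof. by rewrite /kink_energy -[in LHS]div_sqrt2; field; rewrite gt_eqF ?sqrt2_gt0. Qed.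

Lemma kink_energy_le1 : kink_energy <= 1 :> R.
Proof.
rewrite /kink_energy; have := @sqrt2_sqr R; have := @sqrt2_gt0 R.
by move: (Num.sqrt 2) => s s0 ss; nra.
Qed.

Lemma potential_le k s : 0 <= k <= 1 -> 0 <= s -> potential k s <= 2 * s.
Proof.
move=> /andP[k0 k1] s0; have := exprn_ge0 3 s0; have : k ^+ 2 <= 1 by rewrite exprn_ile1.
by rewrite /potential; nra.
Qed.

Lemma potential_rho_ge k v t : 0 < k -> `|1 - modsq v t| < k ^+ 2 ->
  2 / 3 <= potential k (rho k v t).
Proof.
move=> k0; rewrite ltr_norml => nt; have r0 := rho_gt0 k0 v t; have r2 := rho_sqr k v t.
have r1 : 1 <= rho k v t.
  by rewrite -ler_sqr ?nnegrE ?(ltW r0)// r2 expr1n; lra.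
have -> : potential k (rho k v t) = rho k v t * (1 + k ^+ 2 - rho k v t ^+ 2 / 3).
  by rewrite /potential; field.
rewrite -[leLHS]mul1r ler_pM// r2; have := sqr_ge0 k; lra.
Qed.

Lemma rho0_le d v : 0 < d -> modsq v 0 <= d ^+ 2 -> rho d v 0 <= 2 * d.
Proof.
move=> d0 n0; have r0 := rho_gt0 d0 v 0.
rewrite -ler_sqr ?nnegrE ?(ltW r0) ?mulr_ge0 ?(ltW d0)//.
by rewrite rho_sqr; have := sqr_ge0 d; lra.
Qed.

End potential_bounds.

Section almost_kinks.
Context {R : realType}.
Implicit Types (v : wave R) (x y s t c : R).
Notation K := (@kink R).
Notation s2 := (Num.sqrt 2 : R).

Section fixed_wave.
Variables (v : wave R) (d : R).
Hypotheses (d_gt0 : 0 < d) (d_le1 : d <= 1) (vK : almost_kink v d).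

Let Hv : H1loc v. Proof. by case: vK. Qed.
Let ldef : locint (defect d v). Proof. exact: locint_defect. Qed.
Let lene : locint (energy_density v). Proof. exact: locint_energy_density. Qed.

Lemma Int_energy_density_le2 x y : x <= y -> Int x y (energy_density v) <= 2.
Proof.
case: vK => _ _ vE _ xy; apply: (le_trans (vE x y xy)).
by have := kink_energy_le1 (R := R); have := d_le1; lra.
Qed.

(* Both half lines contribute at least [(potential (rho +-oo) - potential (rho 0)) / sqrt 2],
   and these contributions already exhaust the energy of the kink. *)
Lemma Int_defect_le s t : 0 <= s -> s <= t -> Int s t (defect d v) <= 9 * d.
Proof.
case: vK => _ n0 vE vp s0 st; have [d0 d1] := (d_gt0, d_le1); have t0 := le_trans s0 st.
have [x [y [xt ty nx ny _]]] := vp t (d ^+ 2) (exprn_gt0 2 d0).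
have x0 : x <= 0 by lra.
have y0 := le_trans t0 ty.
have def0 r : 0 <= defect d v r by exact: defect_ge0.
apply: (le_trans (Int_sub ldef def0 s0 st ty)).
rewrite Int_defectE//.
have left_half :
    (potential d (rho d v x) - potential d (rho d v 0)) / s2 <= Int x 0 (energy_density v).
  have := potential_rho_le d0 (H1loc_reflect Hv) (_ : 0 <= - x).
  rewrite oppr_ge0 (eq_Int (fun r _ => energy_density_reflect v r)) Int_reflect// opprK oppr0.
  by rewrite /rho !modsq_reflect opprK oppr0; exact.
have := vE x y (le_trans x0 y0); rewrite (Int_cat lene x0 y0) kink_energyE.
have Vx := potential_rho_ge d0 nx; have Vy := potential_rho_ge d0 ny.
have V0 : potential d (rho d v 0) <= 4 * d.
  have d01 : 0 <= d <= 1 by rewrite ltW.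
  by apply: (le_trans (potential_le d01 (ltW (rho_gt0 d0 _ _)))); have := rho0_le d0 n0; lra.
have : (4 / 3 - potential d (rho d v x) - potential d (rho d v y)
    + 2 * potential d (rho d v 0)) / s2 <= 8 * d.
  apply: (@le_trans _ _ (8 * d / s2)); first by rewrite ler_pM2r ?invr_gt0 ?sqrt2_gt0//; lra.
  by rewrite ler_piMr ?mulr_ge0 ?(ltW d0)// invf_le1 ?sqrt2_gt0 ?sqrt2_ge1.
by lra.
Qed.

Lemma Int_norm_rho_error_le x b : 0 <= x -> 0 <= b -> 18 * d * x <= b ^+ 2 ->
  Int 0 x (fun t => `|rho_error d v t|) <= b.
Proof.
move=> x0 b0 xb; have lerr := locint_norm (locint_rho_error d_gt0 Hv).
rewrite -ler_sqr ?nnegrE//; last by apply: Int_ge0.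
have err_le t : 0 <= t <= x -> `|rho_error d v t| ^+ 2 <= 2 * defect d v t.
  by move=> _; rewrite real_normK ?num_real//; exact: rho_error_sqr_le_defect.
apply: (le_trans (sqr_Int_le (locintZ 2 ldef) lerr x0 err_le)).
apply: le_trans xb; rewrite IntZ// subr0; have -> : 18 * d * x = x * (2 * (9 * d)) by ring.
by rewrite ler_wpM2l// ler_pM2l//; exact: Int_defect_le.
Qed.

(* [rho - kink] solves a linear equation with damping [(rho + kink) / sqrt 2] and a
   small right-hand side. *)
Lemma rho_sub_kink_le x b : 0 <= x -> 0 <= b -> 18 * d * x <= b ^+ 2 ->
  `|rho d v x - K x| <= (2 + x) * d + b.
Proof.
case: vK => _ n0 _ _ x0 b0 xb; have [d0 d1] := (d_gt0, d_le1).
have pr := prim_rho d0 Hv; have pk := @prim_kink R.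
pose g t := (rho d v t + K t) / s2.
have lg : locint g.
  have [cr ck] := (prim_continuous pr, prim_continuous pk).
  by apply: continuous_locint; rewrite /g; continuity.
have g0 t : 0 <= t <= x -> 0 <= g t.
  move=> /andP[t0 _]; rewrite divr_ge0 ?(ltW sqrt2_gt0)// addr_ge0 ?kink_ge0//.
  exact/ltW/rho_gt0.
have lerr := locint_rho_error d0 Hv.
have lj := locintD lerr (locint_cst (d ^+ 2 / s2)).
have ode t : radial v t / rho d v t - kink' t =
    (rho_error d v t + d ^+ 2 / s2) - g t * (rho d v t - K t).
  have -> : d ^+ 2 = rho d v t ^+ 2 - modsq v t by rewrite rho_sqr; ring.
  by rewrite /rho_error /g /kink'; field; rewrite !gt_eqF ?sqrt2_gt0 ?rho_gt0.
apply: (le_trans (damped_ode_le (primB pr pk) lg lj x0 g0 (fun t _ => ode t))).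
have rho0 : `|rho d v 0 - K 0| <= 2 * d.
  by rewrite kink0 subr0 gtr0_norm ?rho_gt0//; exact: rho0_le.
have : Int 0 x (fun t => `|rho_error d v t + d ^+ 2 / s2|) <=
    Int 0 x (fun t => `|rho_error d v t| + d).
  apply: le_Int => [||t _]; [exact: locint_norm|exact: locintD (locint_norm lerr) (locint_cst _)|].
  apply: (le_trans (ler_normD _ _)).
  rewrite lerD2l ger0_norm ?divr_ge0 ?sqr_ge0 ?(ltW sqrt2_gt0)//.
  rewrite ler_pdivrMr ?sqrt2_gt0// expr2 ler_pM2l//.
  by apply: (le_trans d1); exact: sqrt2_ge1.
rewrite (IntD _ _ (locint_norm lerr) (locint_cst _)) Int_cst//.
by have := Int_norm_rho_error_le x0 b0 xb; lra.
Qed.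

Lemma sqr_Int_arg_rate_le c s t : 0 < c -> 0 <= s -> s <= t ->
  Int s t (arg_rate v c) ^+ 2 <= (t - s) * (18 / c * d).
Proof.
move=> c0 s0 st; have lr := locint_arg_rate Hv c0.
apply: (le_trans (sqr_Int_le (locintZ (2 / c) ldef) lr st
  (fun r _ => arg_rate_sqr_le_defect d_gt0 v r c0))).
rewrite IntZ// ler_wpM2l ?subr_ge0//.
have -> : 18 / c * d = 2 / c * (9 * d) by field; rewrite gt_eqF.
by rewrite ler_pM2l ?divr_gt0//; exact: Int_defect_le.
Qed.

Lemma sqr_Int_arg_rateB_current_le c s t : 0 < c -> 0 <= s -> s <= t ->
  (forall r, s <= r <= t -> c <= modsq v r) ->
  (Int s t (arg_rate v c) - Int s t (current v)) ^+ 2 <= 144 / c * d.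
Proof.
move=> c0 s0 st cn; have lr := locint_arg_rate Hv c0; have lw := locint_current Hv.
have def0 r : 0 <= defect d v r by exact: defect_ge0.
have ene0 := energy_density_ge0 v; have c8 : 0 < 8 / c by rewrite divr_gt0.
rewrite -IntB//; apply: le_trans (cauchy_schwarz_Int (locintZ (8 / c) lene) ldef (locintB lr lw)
  _ _ (fun r str => arg_rateB_current_sqr_le_defect d_gt0 c0 (cn r str))) _ => [r _|//|].
  by rewrite mulr_ge0// ltW.
have -> : 144 / c * d = 8 / c * 2 * (9 * d) by field; rewrite gt_eqF.
rewrite IntZ//; apply: ler_pM.
- by rewrite mulr_ge0 ?(ltW c8)//; exact: Int_ge0.
- exact: Int_ge0.
- by rewrite ler_pM2l//; exact: Int_energy_density_le2.
- exact: Int_defect_le.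
Qed.

Lemma sqr_Int_current_le t : 0 <= t -> (forall r, 0 <= r <= t -> modsq v r <= 2) ->
  Int 0 t (current v) ^+ 2 <= 36 * t * d.
Proof.
move=> t0 n2; have lw := locint_current Hv.
apply: (le_trans (sqr_Int_le (locintZ 4 ldef) lw t0 _)) => [r /n2 nr|].
  apply: (le_trans (current_sqr_le_defect d_gt0 v r)).
  by rewrite ler_wpM2r ?defect_ge0//; lra.
rewrite IntZ// subr0; have -> : 36 * t * d = t * (4 * (9 * d)) by ring.
by rewrite ler_wpM2l// ler_pM2l//; exact: Int_defect_le.
Qed.

Lemma potential_rho_almost_ndecr s t : 0 <= s -> s <= t ->
  potential d (rho d v s) <= potential d (rho d v t) + 18 * d.
Proof.
move=> s0 st; have := Int_defect_le s0 st; rewrite (Int_defectE d_gt0 Hv)//.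
have : 0 <= Int s t (energy_density v) by apply: Int_ge0 => r _; exact: energy_density_ge0.
move=> e0 def_le; rewrite -lerBlDl.
have : (potential d (rho d v s) - potential d (rho d v t)) / s2 <= 9 * d by lra.
rewrite ler_pdivrMr ?sqrt2_gt0// => V_le.
have : 9 * d * s2 <= 9 * d * 2 by rewrite ler_pM2l ?sqrt2_le2// mulr_gt0.
by lra.
Qed.

Lemma modsq_ge_of_rho k s t : 0 < k -> k <= 1 -> d <= k / 216 -> 0 <= s -> s <= t ->
  `|rho d v s - k| <= k / 4 -> k ^+ 2 / 128 <= modsq v t.
Proof.
move=> k0 k1 dk s0 st; rewrite ler_norml => rs_k.
have [d0 d1] := (d_gt0, d_le1); have [rs rt] := (rho_gt0 d0 v s, rho_gt0 d0 v t).
have V_s : k / 3 <= potential d (rho d v s).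
  have -> : potential d (rho d v s) = rho d v s * (1 + d ^+ 2 - rho d v s ^+ 2 / 3).
    by rewrite /potential; field.
  have rs2 : rho d v s ^+ 2 <= (5 / 4) ^+ 2 by rewrite ler_sqr ?nnegrE ?(ltW rs)//; lra.
  have -> : k / 3 = 3 / 4 * k * (4 / 9) by field.
  by apply: ler_pM; rewrite ?mulr_ge0 ?(ltW k0)//; have := sqr_ge0 d; lra.
have V_t : potential d (rho d v t) <= 2 * rho d v t.
  by apply: potential_le; rewrite ?(ltW rt)// (ltW d0).
have := potential_rho_almost_ndecr s0 st => V_st.
have : (k / 8) ^+ 2 <= rho d v t ^+ 2 by rewrite ler_sqr ?nnegrE ?(ltW rt)//; lra.
have : d ^+ 2 <= (k / 216) ^+ 2 by rewrite ler_sqr ?nnegrE ?(ltW d0)//; lra.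
by rewrite rho_sqr; have := sqr_ge0 k; lra.
Qed.

End fixed_wave.
End almost_kinks.

Section small_parameter.
Context {R : realType}.

Lemma near0_mul_le (C e : R) : 0 < e -> \forall d \near 0^'+, C * d <= e.
Proof.
move=> e0; near=> d; have d0 : 0 < d by near: d; exact: nbhs_right_gt.
have : d <= e / (`|C| + 1) by near: d; apply: nbhs_right_le; rewrite divr_gt0.
rewrite ler_pdivlMr// mulrC => /(le_trans _); apply.
by rewrite ler_wpM2r ?(ltW d0)// (le_trans (ler_norm C))// lerDl.
Unshelve. all: by end_near. Qed.

Lemma ler_norm_of_sqr (x e : R) : 0 <= e -> x ^+ 2 <= e ^+ 2 -> `|x| <= e.
Proof. by move=> e0 xe; rewrite -ler_sqr ?nnegrE// real_normK ?num_real. Qed.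

End small_parameter.

(* In this section, [\forall d \near 0^'+, forall v, almost_kink v d -> P v] says that
   [P v] holds for all waves [v] that are sufficiently close to being optimal. *)
Section nearly_optimal_waves.
Context {R : realType}.
Implicit Types (v : wave R) (x y s t c L e : R).
Notation K := (@kink R).

Lemma near_rho_kink L e : 0 < e -> \forall d \near 0^'+, forall v, almost_kink v d ->
  forall x, 0 <= x <= L -> `|rho d v x - K x| <= e.
Proof.
move=> e0; have e2 : 0 < e / 2 by rewrite divr_gt0.
near=> d => v vK x /andP[x0 xL].
have d0 : 0 < d by near: d; exact: nbhs_right_gt.
have d1 : d <= 1 by near: d; exact: nbhs_right_le.
have dL : (2 + L) * d <= e / 2 by near: d; exact: near0_mul_le.
have dL2 : 18 * L * d <= (e / 2) ^+ 2.
  by near: d; apply: near0_mul_le; rewrite exprn_gt0.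
apply: (le_trans (rho_sub_kink_le d0 d1 vK x0 (ltW e2) _)).
  by apply: le_trans dL2; rewrite mulrAC ler_pM2r// ler_pM2l.
have : (2 + x) * d <= (2 + L) * d by rewrite ler_pM2r// lerD2l.
by lra.
Unshelve. all: by end_near. Qed.

Lemma near_modsq_ge x : 0 < x -> exists2 c, 0 < c &
  \forall d \near 0^'+, forall v, almost_kink v d -> forall y, x <= y -> c <= modsq v y.
Proof.
move=> x0; have K0 := kink_gt0 x0; have := kink_norm_lt1 x; rewrite gtr0_norm// => /ltW K1.
exists (K x ^+ 2 / 128); first by rewrite divr_gt0 ?exprn_gt0.
near=> d => v vK y xy.
have d0 : 0 < d by near: d; exact: nbhs_right_gt.
have d1 : d <= 1 by near: d; exact: nbhs_right_le.
apply: (modsq_ge_of_rho d0 d1 vK K0 K1 _ (ltW x0) xy).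
  by near: d; apply: nbhs_right_le; rewrite divr_gt0.
move: {y xy} v vK; near: d.
have := @near_rho_kink x (K x / 4); rewrite divr_gt0// => /(_ isT); apply: filterS => d.
by move=> rho_K v /rho_K; apply; rewrite (ltW x0) lexx.
Unshelve. all: by end_near. Qed.

Lemma near_Int_arg_rate_le c L e : 0 < c -> 0 < e ->
  \forall d \near 0^'+, forall v, almost_kink v d ->
  forall s t, 0 <= s -> s <= t -> t <= L -> `|Int s t (arg_rate v c)| <= e.
Proof.
move=> c0 e0; near=> d => v vK s t s0 st tL.
have d0 : 0 < d by near: d; exact: nbhs_right_gt.
have d1 : d <= 1 by near: d; exact: nbhs_right_le.
have dL : L * (18 / c) * d <= e ^+ 2 by near: d; apply: near0_mul_le; rewrite exprn_gt0.
apply: ler_norm_of_sqr (ltW e0) _; apply: le_trans dL; rewrite -mulrA.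
apply: (le_trans (sqr_Int_arg_rate_le d0 d1 vK c0 s0 st)).
by rewrite ler_pM2r ?mulr_gt0 ?invr_gt0//; lra.
Unshelve. all: by end_near. Qed.

Lemma near_Int_arg_rateB_current_le c x e : 0 < c -> 0 <= x -> 0 < e ->
  \forall d \near 0^'+, forall v, almost_kink v d -> (forall y, x <= y -> c <= modsq v y) ->
  forall y, x <= y -> `|Int x y (arg_rate v c) - Int x y (current v)| <= e.
Proof.
move=> c0 x0 e0; near=> d => v vK cn y xy.
have d0 : 0 < d by near: d; exact: nbhs_right_gt.
have d1 : d <= 1 by near: d; exact: nbhs_right_le.
apply: ler_norm_of_sqr (ltW e0) _.
apply: (le_trans (sqr_Int_arg_rateB_current_le d0 d1 vK c0 x0 xy _)).
  by move=> r /andP[/cn].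
by near: d; apply: near0_mul_le; rewrite exprn_gt0.
Unshelve. all: by end_near. Qed.

Lemma near_Int_current_le x e : 0 <= x -> 0 < e ->
  \forall d \near 0^'+, forall v, almost_kink v d -> `|Int 0 x (current v)| <= e.
Proof.
move=> x0 e0; near=> d; have d0 : 0 < d by near: d; exact: nbhs_right_gt.
have d1 : d <= 1 by near: d; exact: nbhs_right_le.
have rho_K : forall v, almost_kink v d -> forall y, 0 <= y <= x -> `|rho d v y - K y| <= 1 / 4.
  by near: d; exact: near_rho_kink.
move=> v vK; apply: ler_norm_of_sqr (ltW e0) _.
apply: (le_trans (sqr_Int_current_le d0 d1 vK x0 _)); last first.
  by near: d; apply: near0_mul_le; rewrite exprn_gt0.
move=> y yx; have := rho_K v vK y yx; have := kink_norm_lt1 y.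
rewrite ltr_norml ler_norml => Ky ry.
have : rho d v y ^+ 2 <= (5 / 4) ^+ 2 by rewrite ler_sqr ?nnegrE ?(ltW (rho_gt0 d0 _ _))//; lra.
by rewrite rho_sqr; have := sqr_ge0 d; lra.
Unshelve. all: by end_near. Qed.

End nearly_optimal_waves.

Section convergence_to_the_kink.
Context {R : realType}.
Implicit Types (v : wave R) (x y s L d e alpha beta gamma : R).
Notation K := (@kink R).

Definition kink_close v alpha e x :=
  `|re v x - cos alpha * K x| <= e /\ `|im v x - sin alpha * K x| <= e.

Lemma kink_close_le v alpha e e' x : e <= e' -> kink_close v alpha e x -> kink_close v alpha e' x.
Proof. by move=> ee' [re_le im_le]; split; exact: le_trans ee'. Qed.

Lemma ler_dist_mulr (k z r s : R) : `|k| <= 1 -> `|z - s * k| <= `|r - s| + `|z - r * k|.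
Proof.
move=> k1; have -> : z - s * k = (r - s) * k + (z - r * k) by ring.
by apply: (le_trans (ler_normD _ _)); rewrite normrM lerD2r ler_piMr.
Qed.

Lemma kink_close_angle v alpha beta e x :
  kink_close v alpha e x -> kink_close v beta (`|alpha - beta| + e) x.
Proof.
move=> [re_le im_le]; have K1 := ltW (kink_norm_lt1 x); split.
- by apply: (le_trans (ler_dist_mulr _ _ _ K1)); apply: lerD re_le; exact: cos_lipschitz.
- by apply: (le_trans (ler_dist_mulr _ _ _ K1)); apply: lerD im_le; exact: sin_lipschitz.
Qed.

Lemma kink_close_modulusD v alpha x : 0 <= K x -> kink_close v alpha (modulus v x + K x) x.
Proof.
move=> K0; have dist_le z r : z ^+ 2 <= modsq v x -> `|r| <= 1 ->
    `|z - r * K x| <= modulus v x + K x.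
  move=> zn r1; apply: (le_trans (ler_normB _ _)); apply: lerD.
    by apply: ler_norm_of_sqr (modulus_ge0 v x) _; rewrite modulus_sqr.
  by rewrite normrM (ger0_norm K0) ler_piMl.
split; apply: dist_le.
- by rewrite lerDl sqr_ge0.
- exact: cos_max.
- by rewrite lerDr sqr_ge0.
- exact: sin_max.
Qed.

Lemma kink_close_polar v alpha beta x : is_arg v x beta ->
  kink_close v alpha (`|modulus v x - K x| + `|beta - alpha|) x.
Proof.
move=> [_ reE imE]; rewrite [`|modulus v x - K x| + _]addrC; apply: kink_close_angle.
have dist_le (r : R) : `|r| <= 1 -> `|modulus v x * r - r * K x| <= `|modulus v x - K x|.
  by move=> r1; rewrite [r * _]mulrC -mulrBl normrM ler_piMr.
by rewrite /kink_close reE imE; split; apply: dist_le; [exact: cos_max|exact: sin_max].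
Qed.

Lemma near_kink_close_right L e : 0 < e -> \forall d \near 0^'+, forall v, almost_kink v d ->
  forall alpha, is_arg v 1 alpha -> forall x, 0 <= x <= L -> kink_close v alpha e x.
Proof.
move=> e0; have e4 : 0 < e / 4 by rewrite divr_gt0.
(* Below [x0] both [v] and the kink are small; beyond [x0] the argument is defined. *)
have [x0 [x00 x01 x0e]] : exists x0 : R, [/\ 0 < x0, x0 <= 1 & x0 <= e / 4].
  by exists (Num.min 1 (e / 4)); rewrite lt_min ltr01 !ge_min !lexx orbT.
have [c c0 near_c] := near_modsq_ge x00.
near=> d; have d0 : 0 < d by near: d; exact: nbhs_right_gt.
have de : d <= e / 4 by near: d; exact: nbhs_right_le.
have rho_K : forall v, almost_kink v d -> forall x, 0 <= x <= L -> `|rho d v x - K x| <= e / 4.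
  by near: d; apply: near_rho_kink.
have cv : forall v, almost_kink v d -> forall y, x0 <= y -> c <= modsq v y.
  by near: d; exact: near_c.
have arg_le : forall v, almost_kink v d -> forall s t, 0 <= s -> s <= t -> t <= Num.max 1 L ->
    `|Int s t (arg_rate v c)| <= e / 4.
  by near: d; exact: near_Int_arg_rate_le.
move=> v vK alpha v1 x xL; have [x_ge0 x_leL] := andP xL; have [Hv _ _ _] := vK.
have modulus_K : `|modulus v x - K x| <= e / 2.
  have := rho_K v vK x xL; have := rho_le_modulus d0 v x; have := modulus_le_rho d v x.
  by rewrite !ler_norml; lra.
have [xx0|/ltW x0x] := leP x x0.
  apply: kink_close_le (kink_close_modulusD _ _ (kink_ge0 x_ge0)).
  by move: modulus_K; rewrite ler_norml; have := kink_le x_ge0; lra.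
suff [beta vx beta_alpha] : exists2 beta, is_arg v x beta & `|beta - alpha| <= e / 4.
  by apply: kink_close_le (kink_close_polar alpha vx); lra.
have cn s t : x0 <= s -> forall r, s <= r <= t -> c <= modsq v r.
  by move=> xs r /andP[sr _]; apply: cv => //; exact: le_trans sr.
have [x1|/ltW x1] := leP x 1.
  exists (alpha - Int x 1 (arg_rate v c)); first exact: is_arg_lift_left (cn _ _ x0x) v1.
  by rewrite addrAC subrr add0r normrN arg_le// le_max lexx.
exists (alpha + Int 1 x (arg_rate v c)); first exact: is_arg_lift (cn _ _ x01) v1.
by rewrite addrAC subrr add0r arg_le// le_max x_leL orbT.
Unshelve. all: by end_near. Qed.

Lemma Int_current_halves v x y : H1loc v -> x <= -1 -> 1 <= y -> Int x y (current v) =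
  (Int 0 1 (current v) + Int 1 y (current v)) -
  (Int 0 1 (current (reflect v)) + Int 1 (- x) (current (reflect v))).
Proof.
move=> Hv x1 y1; have lw := locint_current Hv.
have x0 : x <= 0 by lra.
have y0 : 0 <= y by lra.
rewrite !Int_current_reflect// !opprK oppr0 (Int_cat lw x0 y0).
by rewrite (Int_cat lw ler01 y1) (Int_cat lw x1 (lerN10 R)); ring.
Qed.

Lemma near_antipodal e : 0 < e -> \forall d \near 0^'+, forall v, almost_kink v d ->
  forall alpha gamma, is_arg v 1 alpha -> is_arg v (-1) gamma ->
  `|cos alpha + cos gamma| <= e /\ `|sin alpha + sin gamma| <= e.
Proof.
move=> e0; have e8 : 0 < e / 8 by rewrite divr_gt0.
have [c c0 near_c] := near_modsq_ge (@ltr01 R).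
near=> d; have de : d <= e / 4 by near: d; apply: nbhs_right_le; rewrite divr_gt0.
have cv : forall v, almost_kink v d -> forall y, 1 <= y -> c <= modsq v y.
  by near: d; exact: near_c.
have tail_le : forall v, almost_kink v d -> (forall y, 1 <= y -> c <= modsq v y) ->
    forall y, 1 <= y -> `|Int 1 y (arg_rate v c) - Int 1 y (current v)| <= e / 8.
  by near: d; exact: near_Int_arg_rateB_current_le.
have core_le : forall v, almost_kink v d -> `|Int 0 1 (current v)| <= e / 8.
  by near: d; exact: near_Int_current_le.
move=> v vK alpha gamma v1 vN1; have wK := almost_kink_reflect vK.
have [Hv _ _ vp] := vK; have [Hw _ _ _] := wK; set w := reflect v in wK Hw.
have [x [y [x1 y1 _ _ arg_xy]]] := vp 1 1 ltr01.
have Nx1 : 1 <= - x by rewrite lerNr.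
have vy := is_arg_lift Hv c0 y1 (fun t ty => cv v vK t (proj1 (andP ty))) v1.
have wN1 : is_arg w 1 gamma by rewrite is_arg_reflect.
have wx := is_arg_lift Hw c0 Nx1 (fun t tx => cv w wK t (proj1 (andP tx))) wN1.
rewrite is_arg_reflect opprK in wx.
have [k] := arg_xy _ _ wx vy; have [cos_le sin_le] := antipodal_lipschitz alpha gamma k.
move=> p_k; suff close : `|alpha - gamma + pi + 2 * (k%:~R * pi)| <= e.
  by split; [exact: le_trans cos_le close|exact: le_trans sin_le close].
have := core_le v vK; have := core_le w wK.
have := tail_le v vK (cv v vK) y y1; have := tail_le w wK (cv w wK) _ Nx1.
by move: p_k; rewrite Int_current_halves// -/w ltr_norml !ler_norml; lra.
Unshelve. all: by end_near. Qed.

Lemma near_kink_close L e : 0 < e -> \forall d \near 0^'+, forall v, almost_kink v d ->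
  forall alpha, is_arg v 1 alpha -> forall x, - L <= x <= L -> kink_close v alpha e x.
Proof.
move=> e0; have e2 : 0 < e / 2 by rewrite divr_gt0.
have [c c0 near_c] := near_modsq_ge (@ltr01 R).
near=> d; have cv : forall v, almost_kink v d -> forall y, 1 <= y -> c <= modsq v y.
  by near: d; exact: near_c.
have right_close : forall v, almost_kink v d -> forall alpha, is_arg v 1 alpha ->
    forall x, 0 <= x <= L -> kink_close v alpha (e / 2) x.
  by near: d; exact: near_kink_close_right.
have antipodal : forall v, almost_kink v d -> forall alpha gamma, is_arg v 1 alpha ->
    is_arg v (-1) gamma -> `|cos alpha + cos gamma| <= e / 2 /\ `|sin alpha + sin gamma| <= e / 2.
  by near: d; exact: near_antipodal.
move=> v vK alpha v1 x xL; have [x0|x0] := leP 0 x.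
  apply: kink_close_le (right_close v vK alpha v1 x _); first lra.
  by rewrite x0; case/andP: xL.
have wK := almost_kink_reflect vK.
have [gamma _ wgamma] := exists_arg (lt_le_trans c0 (cv _ wK 1 (lexx 1))).
have [cos_le sin_le] := antipodal v vK alpha gamma v1 wgamma.
have [|] := right_close _ wK gamma wgamma (- x); first lra.
have mul_kinkN s : s * K (- x) = - s * K x by rewrite kinkN mulrN mulNr.
rewrite /= opprK !mul_kinkN => re_le im_le; have K1 := ltW (kink_norm_lt1 x).
rewrite /kink_close [e]splitr; split; apply: (le_trans (ler_dist_mulr _ _ _ K1)).
- by apply: lerD re_le; rewrite distrC opprK.
- by apply: lerD im_le; rewrite distrC opprK.
Unshelve. all: by end_near. Qed.

End convergence_to_the_kink.

Section kink_energy_density.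
Context {R : realType}.
Implicit Types (x y L : R).
Notation K := (@kink R).
Notation K' := (@kink' R).
Notation s2 := (Num.sqrt 2 : R).

Definition kink_wave : wave R := Wave K (fun=> 0) K' (fun=> 0).

Lemma H1loc_kink_wave : H1loc kink_wave.
Proof.
split; [exact: prim_kink|exact: prim_cst|].
by apply: continuous_locint; have ck := @continuous_kink' R; rewrite /speedsq /=; continuity.
Qed.

Lemma energy_density_kink_wave x : energy_density kink_wave x = K' x ^+ 2.
Proof.
rewrite /energy_density /speedsq /modsq /= expr0n/= !addr0.
have -> : (1 - K x ^+ 2) ^+ 2 = 2 * K' x ^+ 2.
  by rewrite [K' x ^+ 2]expr_div_n sqrt2_sqr; field.
by field.
Qed.

Lemma Int_sqr_kink' x y : x <= y ->
  Int x y (fun t => K' t ^+ 2) = ((K y - K y ^+ 3 / 3) - (K x - K x ^+ 3 / 3)) / s2.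
Proof.
move=> xy; have pk := @prim_kink R.
have := primE (primZ s2^-1 (primB pk (primZ 3^-1 (primM (prim_sqr pk) pk)))) xy.
rewrite -mulrBr mulrC => E.
transitivity ((K y - 3^-1 * (K y ^+ 2 * K y) - (K x - 3^-1 * (K x ^+ 2 * K x))) / s2); last first.
  by field; rewrite gt_eqF ?sqrt2_gt0.
rewrite -E; apply: eq_Int => t _; rewrite /kink'.
by field; rewrite gt_eqF ?sqrt2_gt0.
Qed.

Lemma energy_le_kink_wave : energy_le kink_wave kink_energy.
Proof.
move=> x y xy; rewrite (eq_Int (fun t _ => energy_density_kink_wave t)) Int_sqr_kink'//.
rewrite kink_energyE ler_pM2r ?invr_gt0 ?sqrt2_gt0//.
have bound (s : R) : `|s| < 1 -> - (2 / 3) <= s - s ^+ 3 / 3 <= 2 / 3.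
  rewrite ltr_norml => /andP[s_gt s_lt].
  have : 0 <= (1 - s) ^+ 2 * (s + 2) by rewrite mulr_ge0 ?sqr_ge0//; lra.
  have : 0 <= (1 + s) ^+ 2 * (2 - s) by rewrite mulr_ge0 ?sqr_ge0//; lra.
  by lra.
by have := bound _ (kink_norm_lt1 x); have := bound _ (kink_norm_lt1 y); lra.
Qed.

Lemma Int_sqr_kink'_ge L : 0 <= L ->
  kink_energy - 2 * (1 - K L) <= Int (- L) L (fun t => K' t ^+ 2).
Proof.
move=> L0; rewrite Int_sqr_kink' ?kinkN ?kink_energyE; last lra.
have := kink_norm_lt1 L; rewrite ltr_norml; have := kink_ge0 L0.
move: (K L) => s s0 /andP[_ /ltW s1].
have -> : (s - s ^+ 3 / 3 - (- s - (- s) ^+ 3 / 3)) / s2 =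
    4 / 3 / s2 - 2 * (1 - s) * ((1 - s) * (s + 2) / 3 / s2).
  by field; rewrite gt_eqF ?sqrt2_gt0.
rewrite lerD2l lerN2 ler_piMr ?mulr_ge0 ?subr_ge0//.
rewrite ler_pdivrMr ?sqrt2_gt0// mul1r; apply: le_trans sqrt2_ge1.
by have := sqr_ge0 s; lra.
Qed.

End kink_energy_density.

Section energy_gap.
Context {R : realType}.
Implicit Types (v : wave R) (x y t theta : R).
Notation K := (@kink R).
Notation K' := (@kink' R).
Notation s2 := (Num.sqrt 2 : R).

Definition gap v theta t :=
  2^-1 * ((re' v t - cos theta * K' t) ^+ 2 + (im' v t - sin theta * K' t) ^+ 2)
  + 4^-1 * ((1 - modsq v t) - (1 - K t ^+ 2)) ^+ 2.

Lemma gap_ge0 v theta t : 0 <= gap v theta t.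
Proof. by rewrite /gap addr_ge0// mulr_ge0 ?addr_ge0 ?sqr_ge0. Qed.

Lemma gap_le v theta t : gap v theta t <= 2 * (energy_density v t + K' t ^+ 2).
Proof.
rewrite -energy_density_kink_wave /gap /energy_density /speedsq /modsq /= expr0n/= !addr0.
have := sqr_ge0 (re' v t + cos theta * K' t); have := sqr_ge0 (im' v t + sin theta * K' t).
have := sqr_ge0 ((1 - (re v t ^+ 2 + im v t ^+ 2)) + (1 - K t ^+ 2)).
have : (cos theta ^+ 2 + sin theta ^+ 2) * K' t ^+ 2 = K' t ^+ 2 by rewrite cos2Dsin2 mul1r.
by lra.
Qed.

Lemma gapE v theta t : gap v theta t = energy_density v t - K' t ^+ 2
  - K' t * (cos theta * re' v t + sin theta * im' v t - K' t)
  + s2 / 2 * ((modsq v t - K t ^+ 2) * K' t).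
Proof.
have potentialE : (1 - modsq v t) ^+ 2 =
    2 * K' t ^+ 2 - 2 * s2 * K' t * (modsq v t - K t ^+ 2) + (modsq v t - K t ^+ 2) ^+ 2.
  rewrite -[in 2 * K' t ^+ 2]sqrt2_sqr; have s2K' : 1 - K t ^+ 2 = s2 * K' t.
    by rewrite mulrC divfK// gt_eqF ?sqrt2_gt0.
  have -> : 1 - modsq v t = s2 * K' t - (modsq v t - K t ^+ 2) by rewrite -s2K'; ring.
  by ring.
rewrite /gap /energy_density potentialE /speedsq.
transitivity (2^-1 * (re' v t ^+ 2 + im' v t ^+ 2)
  - K' t * (cos theta * re' v t + sin theta * im' v t)
  + 2^-1 * ((cos theta ^+ 2 + sin theta ^+ 2) * K' t ^+ 2) + 4^-1 * (modsq v t - K t ^+ 2) ^+ 2).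
  by field.
by rewrite cos2Dsin2; field.
Qed.

Section near_rotated_kink.
Variables (v : wave R) (theta L tau eps : R).
Hypotheses (Hv : H1loc v) (L_ge0 : 0 <= L) (tau01 : 0 <= tau <= 1).
Hypothesis v_energy : energy_le v (kink_energy + eps).
Hypothesis v_close : forall x, - L <= x <= L -> kink_close v theta tau x.

Let along t := cos theta * re v t + sin theta * im v t - K t.
Let along' t := cos theta * re' v t + sin theta * im' v t - K' t.

Lemma prim_along : is_prim along along'.
Proof.
have [pre pim _] := Hv.
exact: primB (primD (primZ (cos theta) pre) (primZ (sin theta) pim)) (@prim_kink R).
Qed.

Let lK'2 : locint (fun t => K' t ^+ 2).
Proof. by have ck' := @continuous_kink' R; apply: continuous_locint; continuity. Qed.

Let lcross : locint (fun t => K' t * along' t).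
Proof. by apply: locintM (prim_locint prim_along); exact: continuous_kink'. Qed.

Let ldiff : locint (fun t => (modsq v t - K t ^+ 2) * K' t).
Proof.
have [cn ck ck'] := And3 (continuous_modsq Hv) (@continuous_kink R) (@continuous_kink' R).
by apply: continuous_locint; continuity.
Qed.

Lemma locint_gap : locint (gap v theta).
Proof.
rewrite (funext (gapE v theta)); apply: locintD; last exact: locintZ.
by apply: locintB lcross; apply: locintB lK'2; exact: locint_energy_density.
Qed.

Lemma along_le x : - L <= x <= L -> `|along x| <= 2 * tau.
Proof.
move=> /v_close[re_le im_le].
have -> : along x = cos theta * (re v x - cos theta * K x) + sin theta * (im v x - sin theta * K x).
  by rewrite /along -{1}[K x]mul1r -(cos2Dsin2 theta); ring.
apply: (le_trans (ler_normD _ _)); rewrite !normrM mulr2n mulrDl mul1r.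
by apply: lerD; rewrite -[leRHS]mul1r; apply: ler_pM => //; [exact: cos_max|exact: sin_max].
Qed.

Lemma modsq_sub_sqr_kink_le x : - L <= x <= L -> `|modsq v x - K x ^+ 2| <= 6 * tau.
Proof.
move=> xL; have [re_le im_le] := v_close xL; have [tau0 tau1] := andP tau01.
have -> : modsq v x - K x ^+ 2 = 2 * K x * along x
    + ((re v x - cos theta * K x) ^+ 2 + (im v x - sin theta * K x) ^+ 2).
  transitivity (modsq v x - (2 - (cos theta ^+ 2 + sin theta ^+ 2)) * K x ^+ 2).
    by rewrite cos2Dsin2; ring.
  by rewrite /modsq /along; ring.
have sqr_le z : `|z| <= tau -> z ^+ 2 <= tau.
  move=> z_tau; rewrite -real_normK ?num_real// expr2 -[leRHS]mulr1.
  by apply: ler_pM => //; exact: le_trans tau1.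
have cross_le : `|2 * K x * along x| <= 4 * tau.
  rewrite normrM; have -> : 4 * tau = 2 * (2 * tau) by ring.
  apply: ler_pM => //; last exact: along_le.
  by rewrite normrM gtr0_norm// ler_piMr// ltW// kink_norm_lt1.
apply: (le_trans (ler_normD _ _)).
rewrite [`|_ ^+ 2 + _|]ger0_norm ?addr_ge0 ?sqr_ge0//.
by have := sqr_le _ re_le; have := sqr_le _ im_le; lra.
Qed.

Let NL_le_L : - L <= L. Proof. by have := L_ge0; lra. Qed.

Lemma Int_kink'_le2 : Int (- L) L K' <= 2.
Proof.
rewrite (primE (@prim_kink R) NL_le_L) kinkN opprK.
by have := kink_norm_lt1 L; rewrite ltr_norml; lra.
Qed.

Lemma Int_modsq_diff_le : Int (- L) L (fun t => (modsq v t - K t ^+ 2) * K' t) <= 12 * tau.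
Proof.
have lK' := continuous_locint (@continuous_kink' R); have [tau0 _] := andP tau01.
apply: (@le_trans _ _ (Int (- L) L (fun t => 6 * tau * K' t))); last first.
  by rewrite IntZ//; have := Int_kink'_le2; nra.
apply: le_Int => [||t tL]; [exact: ldiff|exact: locintZ|].
rewrite ler_pM2r ?kink'_gt0//.
by apply: le_trans (ler_norm _) _; exact: modsq_sub_sqr_kink_le.
Qed.

(* Integration by parts moves the derivative onto the smooth factor [K']. *)
Lemma Int_along'_le : `|Int (- L) L (fun t => K' t * along' t)| <= 12 * tau.
Proof.
have pa := prim_along; have ca := prim_continuous pa; have [tau0 _] := andP tau01.
have [ck ck'] := (@continuous_kink R, @continuous_kink' R); have lK' := continuous_locint ck'.
have laK : locint (fun t => along t * - (s2 * K t * K' t)) by apply: continuous_locint; continuity.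
have K'1 t : `|K' t| <= 1 by rewrite gtr0_norm ?kink'_gt0// kink'_le1.
have parts := primE (primM pa (@prim_kink' R)) NL_le_L; rewrite IntD// in parts.
have boundary t : - L <= t <= L -> `|along t * K' t| <= 2 * tau.
  by move=> /along_le a_le; rewrite normrM -[leRHS]mulr1 ler_pM.
have interior : `|Int (- L) L (fun t => along t * - (s2 * K t * K' t))| <= 8 * tau.
  apply: (@le_trans _ _ (Int (- L) L (fun t => 4 * tau * K' t))); last first.
    by rewrite IntZ//; have := Int_kink'_le2; nra.
  apply: Int_norm_le => [||t /along_le a_le]; [exact: laK|exact: locintZ|].
  rewrite mulrN normrN mulrA normrM (gtr0_norm (kink'_gt0 t)) ler_pM2r ?kink'_gt0//.
  have -> : 4 * tau = 2 * tau * 2 by ring.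
  rewrite normrM ler_pM// normrM gtr0_norm ?sqrt2_gt0// -[leRHS]mulr1.
  by rewrite ler_pM ?(ltW sqrt2_gt0) ?sqrt2_le2// ltW// kink_norm_lt1.
have := boundary L; have := boundary (- L); rewrite !NL_le_L !lexx => /(_ isT) + /(_ isT).
by move: parts interior; rewrite !ler_norml; lra.
Qed.

Lemma Int_gap_window_le : Int (- L) L (gap v theta) <=
  Int (- L) L (energy_density v) - Int (- L) L (fun t => K' t ^+ 2) + 24 * tau.
Proof.
have le_dens := locint_energy_density Hv.
rewrite (eq_Int (fun t _ => gapE v theta t)).
rewrite (IntD _ _ (locintB (locintB le_dens lK'2) lcross) (locintZ _ ldiff)).
rewrite (IntB _ _ (locintB le_dens lK'2) lcross) (IntB _ _ le_dens lK'2) IntZ//.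
have : s2 / 2 * Int (- L) L (fun t => (modsq v t - K t ^+ 2) * K' t) <= 12 * tau.
  have [tau0 _] := andP tau01; apply: (@le_trans _ _ (s2 / 2 * (12 * tau))).
    by rewrite ler_pM2l ?divr_gt0 ?sqrt2_gt0//; exact: Int_modsq_diff_le.
  by rewrite ler_piMl ?mulr_ge0// ler_pdivrMr// mul1r sqrt2_le2.
by have := Int_along'_le; rewrite ler_norml; lra.
Qed.

Lemma Int_gap_le x y : x <= y ->
  Int x y (gap v theta) <= 2 * eps + 48 * tau + 8 * (1 - K L).
Proof.
move=> xy; have le_dens := locint_energy_density Hv; have lg := locint_gap.
pose x' := Num.min x (- L); pose y' := Num.max y L.
have [x'x x'L] : x' <= x /\ x' <= - L by rewrite !ge_min !lexx orbT.
have [yy' Ly'] : y <= y' /\ L <= y' by rewrite !le_max !lexx orbT.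
have x'y' : - L <= y' := le_trans NL_le_L Ly'.
apply: (le_trans (Int_sub lg (gap_ge0 v theta) x'x xy yy')).
have tail s t : Int s t (gap v theta) <=
    2 * (Int s t (energy_density v) + Int s t (fun r => K' r ^+ 2)).
  rewrite -IntD// -IntZ; last exact: locintD.
  by apply: le_Int => [||r _]; [exact: lg|exact/locintZ/locintD|exact: gap_le].
have := v_energy (le_trans x'L x'y'); have := energy_le_kink_wave (le_trans x'L x'y').
rewrite (eq_Int (fun t _ => energy_density_kink_wave t)).
rewrite !(Int_cat _ x'L x'y') ?(Int_cat _ NL_le_L Ly')//.
have := Int_gap_window_le; have := tail x' (- L); have := tail L y'.
have := Int_sqr_kink'_ge L_ge0.
have : 0 <= Int (- L) L (gap v theta) by apply: Int_ge0 => t _; exact: gap_ge0.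
by lra.
Qed.

End near_rotated_kink.
End energy_gap.

Section finite_energy_maps.
Context {R : realType}.
Notation mu := (@lebesgue_measure R).
Notation K := (@kink R).
Notation K' := (@kink' R).
Implicit Types (v : wave R) (a b : R -> R) (E p eps alpha beta : R).

Lemma L2_locint_sqr (f : R -> R) : L2 f -> locint (fun t => f t ^+ 2).
Proof.
move=> [mf fi]; apply: integrable_locint; apply/integrableP; split.
  by apply/measurable_EFinP; exact: measurable_funX.
by under eq_integral do rewrite gee0_abs ?lee_fin ?sqr_ge0//.
Qed.

Lemma X1_H1loc a b a' b' : X1 a b a' b' -> H1loc (Wave a b a' b').
Proof.
move=> [pa [pb [_ [la [lb _]]]]]; split => //.
by apply: locintD; exact: L2_locint_sqr.
Qed.

Lemma energy_integral v : H1loc v ->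
  energy (re v) (im v) (re' v) (im' v) = (\int[mu]_t (energy_density v t)%:E)%E.
Proof.
move=> Hv; have [_ _ lv'] := Hv; have cn := continuous_modsq Hv.
have m_speedsq : measurable_fun setT (speedsq v) by exact: locint_measurable.
have m_potential : measurable_fun setT (fun t => (1 - modsq v t) ^+ 2).
  by apply: locint_measurable; apply: continuous_locint; continuity.
rewrite /energy -!ge0_integralZl_EFin//; last 4 first.
- by move=> t _; rewrite lee_fin sqr_ge0.
- exact/measurable_EFinP.
- by move=> t _; rewrite lee_fin addr_ge0 ?sqr_ge0.
- exact/measurable_EFinP.
rewrite -ge0_integralD//.
- by move=> t _; rewrite -EFinM lee_fin mulr_ge0// addr_ge0 ?sqr_ge0.
- by apply/measurable_EFinP; exact: measurable_funM.
- by move=> t _; rewrite -EFinM lee_fin mulr_ge0// sqr_ge0.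
- by apply/measurable_EFinP; exact: measurable_funM.
Qed.

Lemma energy_leP v E : H1loc v ->
  (energy (re v) (im v) (re' v) (im' v) <= E%:E)%E <-> energy_le v E.
Proof.
move=> Hv; rewrite energy_integral//; apply: integral_leP.
  exact: locint_energy_density.
exact: energy_density_ge0.
Qed.

Lemma exists_symmetric_modsq_near1 v E r eta : H1loc v -> energy_le v E -> 0 < eta ->
  exists2 t, r <= t & `|1 - modsq v t| < eta /\ `|1 - modsq v (- t)| < eta.
Proof.
move=> Hv vE eta0; have wE := energy_le_reflect Hv vE; set w := reflect v in wE.
have [le_v le_w] := (locint_energy_density Hv, locint_energy_density (H1loc_reflect Hv)).
have sum_ge0 t : 0 <= energy_density v t + energy_density w t.
  by rewrite addr_ge0 ?energy_density_ge0.
have sum_le x y : x <= y ->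
    Int x y (fun t => energy_density v t + energy_density w t) <= E + E.
  by move=> xy; rewrite IntD// lerD ?vE ?wE.
have eta2 : 0 < eta ^+ 2 / 4 by rewrite divr_gt0 ?exprn_gt0.
have [t rt small_t] := exists_small_value (locintD le_v le_w) sum_ge0 sum_le r eta2.
have sqr_lt s : energy_density v s < eta ^+ 2 / 4 -> `|1 - modsq v s| < eta.
  move=> vs; rewrite -ltr_sqr ?nnegrE ?(ltW eta0)// real_normK ?num_real//.
  by have := potential_le_energy_density v s; lra.
have := energy_density_ge0 v t; have := energy_density_ge0 v (- t).
rewrite energy_density_reflect in small_t.
by exists t => //; split; apply: sqr_lt; lra.
Qed.

Lemma is_arg_arg_diff v r alpha beta : is_arg v (- r) alpha -> is_arg v r beta ->
  arg_diff (re v) (im v) r (beta - alpha).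
Proof.
move=> [nN reN imN] [nP reP imP]; rewrite /arg_diff reN imN reP imP cosB sinB.
have m_gt0 : 0 < modulus v r * modulus v (- r) by rewrite mulr_gt0 ?sqrtr_gt0.
have -> : Num.sqrt (
    (modulus v r * cos beta * (modulus v (- r) * cos alpha) +
     modulus v r * sin beta * (modulus v (- r) * sin alpha)) ^+ 2 +
    (modulus v r * sin beta * (modulus v (- r) * cos alpha) -
     modulus v r * cos beta * (modulus v (- r) * sin alpha)) ^+ 2) =
    modulus v r * modulus v (- r).
  rewrite -[RHS](ger0_norm (ltW m_gt0)) -sqrtr_sqr; congr Num.sqrt.
  transitivity ((modulus v r * modulus v (- r)) ^+ 2 *
    ((cos alpha ^+ 2 + sin alpha ^+ 2) * (cos beta ^+ 2 + sin beta ^+ 2))); first by ring.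
  by rewrite !cos2Dsin2 !mulr1.
by split=> //; split; ring.
Qed.

Lemma momentum_is_near v E p eps (k : int) : H1loc v -> energy_le v E -> 0 < eps ->
  momentum_is (re v) (im v) (re' v) (im' v) p -> `|p - pi / 2 - k%:~R * pi| < eps / 2 ->
  momentum_near_pi2 v eps.
Proof.
move=> Hv vE eps0 vp p_k r eta eta0; have eps2 : 0 < eps / 2 by rewrite divr_gt0.
have [r0 vp_r0] := vp _ eps2.
have [t + [nt nNt]] := exists_symmetric_modsq_near1 (Num.max r0 r) Hv vE eta0.
rewrite ge_max => /andP[r0t rt].
exists (- t), t; split; rewrite ?lerN2// => alpha beta v_alpha v_beta.
have [j p_j] := vp_r0 t (beta - alpha) r0t (is_arg_arg_diff v_alpha v_beta).
exists (j + k); rewrite intrD; set X := _ - 2^-1 * (beta - alpha) in p_j *.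
have -> : X - pi / 2 - (j%:~R + k%:~R) * pi = (X - p - j%:~R * pi) + (p - pi / 2 - k%:~R * pi).
  by ring.
by apply: (le_lt_trans (ler_normD _ _)); rewrite [ltRHS]splitr ltrD.
Qed.

Lemma X1_kink : X1 K (fun=> 0) K' (fun=> 0).
Proof.
have [ck ck'] := (@continuous_kink R, @continuous_kink' R).
have L2_of (f : R -> R) : continuous f -> (forall t, f t ^+ 2 <= 2 * K' t ^+ 2) -> L2 f.
  move=> cf fK'; split; first exact: (locint_measurable (continuous_locint cf)).
  apply: (@le_lt_trans _ _ (2 * kink_energy)%:E); last exact: ltry.
  have lf2 : locint (fun t => f t ^+ 2) by apply: continuous_locint; continuity.
  apply/(integral_leP _ lf2 (fun t => sqr_ge0 (f t))) => x y xy.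
  have lK'2 : locint (fun t => K' t ^+ 2) by apply: continuous_locint; continuity.
  apply: (@le_trans _ _ (Int x y (fun t => 2 * K' t ^+ 2))).
    by apply: le_Int => [//||t _//]; exact: locintZ.
  rewrite IntZ// ler_pM2l//; have := energy_le_kink_wave xy.
  by rewrite (eq_Int (fun t _ => energy_density_kink_wave t)).
split; first exact: prim_kink.
split; first exact: prim_cst.
split.
  exists 1 => x; rewrite expr0n/= addr0 -real_normK ?num_real// exprn_ile1//.
  exact/ltW/kink_norm_lt1.
split; first by apply: L2_of => // t; have := sqr_ge0 (K' t); lra.
split.
  apply: L2_of => [t|t]; first exact: cvg_cst.
  by rewrite expr0n mulr_ge0 ?sqr_ge0.
apply: L2_of => [|t]; first by continuity.
by rewrite expr0n/= addr0 [K' t ^+ 2]expr_div_n sqrt2_sqr mulrC divfK.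
Qed.

Lemma momentum_is_kink : momentum_is K (fun=> 0) K' (fun=> 0) (pi / 2).
Proof.
move=> eps eps0; exists 1 => r phi r1 [].
rewrite !mul0r !mulr0 !addr0 subrr expr0n/= addr0 sqrtr_sqr kinkN mulrN normrN.
have k0 : 0 < K r by apply: kink_gt0; lra.
have kk0 : 0 < K r * K r by rewrite mulr_gt0.
rewrite (gtr0_norm kk0) => _ [cosE _].
have [k phiE] : exists k : int, phi - pi = 2 * (k%:~R * pi).
  apply: cos_eq1; rewrite cosB cospi sinpi mulr0 addr0 mulrN1.
  by apply: (mulIf (lt0r_neq0 kk0)); rewrite mulNr cosE opprK mul1r.
exists (- (k + 1)); rewrite (@eq_Int _ _ _ _ (fun=> 0)) => [|t _]; last first.
  by rewrite /momentum_density mulr0 mul0r subrr.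
rewrite Int_cst; last lra.
rewrite mul0r mulr0 mulrNz intrD -[phi](subrK pi) phiE.
have -> : 0 - 2^-1 * (2 * (k%:~R * pi) + pi) - pi / 2 - - (k%:~R + 1%:~R) * pi = 0 :> R.
  by field.
by rewrite normr0.
Qed.

Lemma Emin_pi2_le_kink_energy : (Emin_pi2 R <= kink_energy%:E)%E.
Proof.
apply: (@le_trans _ _ (energy K (fun=> 0) K' (fun=> 0))).
  apply: ereal_inf_lbound; exists K, (fun=> 0), K', (fun=> 0).
  by split => //; [exact: X1_kink|exact: momentum_is_kink].
by apply/(energy_leP _ (@H1loc_kink_wave R)); exact: energy_le_kink_wave.
Qed.

End finite_energy_maps.

Section sequences_of_integrals.
Context {R : realType}.
Notation mu := (@lebesgue_measure R).

Lemma cvge0_near_le (u : nat -> \bar R) : (forall n, (0 <= u n)%E) ->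
  (forall e, 0 < e -> \forall n \near \oo, (u n <= e%:E)%E) -> u @ \oo --> 0%E.
Proof.
move=> u0 u_le; have fin_u n e : (u n <= e%:E)%E -> u n \is a fin_num.
  by move=> ue; rewrite ge0_fin_numE// (le_lt_trans ue) ?ltry.
apply/fine_cvgP; split; first by apply: filterS (u_le 1 ltr01) => n; exact: fin_u.
apply/cvgrPdist_le => e e0; apply: filterS (u_le e e0) => n ue /=.
rewrite sub0r normrN ger0_norm ?fine_ge0// -lee_fin fineK//; exact: fin_u ue.
Qed.

Lemma cvg0_integral (f : nat -> R -> R) : (forall n, locint (f n)) ->
  (forall n t, 0 <= f n t) ->
  (forall e, 0 < e -> \forall n \near \oo, forall x y, x <= y -> Int x y (f n) <= e) ->
  (fun n => \int[mu]_t (f n t)%:E)%E @ \oo --> 0%E.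
Proof.
move=> lf f0 f_le; apply: cvge0_near_le => [n|e e0].
  by apply: integral_ge0 => t _; rewrite lee_fin.
by apply: filterS (f_le e e0) => n fn; apply/(integral_leP _ (lf n) (f0 n)).
Qed.

Lemma leq_subseq (s : nat -> nat) : {homo s : m n / (m < n)%N} -> forall n, (n <= s n)%N.
Proof. by move=> s_incr; elim=> // n IH; apply: leq_ltn_trans IH (s_incr _ _ _). Qed.

Lemma near_subseq (s : nat -> nat) (P : nat -> Prop) : {homo s : m n / (m < n)%N} ->
  (\forall n \near \oo, P n) -> \forall n \near \oo, P (s n).
Proof.
move=> s_incr [N _ NP]; exists N => // n /= Nn; apply: NP.
exact: leq_trans Nn (leq_subseq s_incr n).
Qed.

Lemma subseq_cvg_of_bounded (u : nat -> R) M : (forall n, `|u n| <= M) ->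
  exists (s : nat -> nat) (l : R), {homo s : m n / (m < n)%N} /\ (u \o s) @ \oo --> l.
Proof.
move=> uM; have [|s s_incr /cvg_ex[l sl]] := @bolzano_weierstrass R u.
  by exists M; split; [exact: num_real|move=> x Mx n _; exact: le_trans (ltW Mx)].
by exists s, l; split => // m n; rewrite (leqW_mono s_incr).
Qed.

End sequences_of_integrals.

Section minimizing_sequences.
Context {R : realType}.
Implicit Types (u : nat -> wave R) (theta e d L : R).

Lemma eventually_energy_le_kink u : (forall n, H1loc (u n)) ->
  (fun n => energy (re (u n)) (im (u n)) (re' (u n)) (im' (u n))) @ \oo --> Emin_pi2 R ->
  forall e, 0 < e -> \forall n \near \oo, energy_le (u n) (kink_energy + e).
Proof.
move=> Hu uE e e0; have lt_e : (Emin_pi2 R < (kink_energy + e)%:E)%E.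
  by apply: le_lt_trans (@Emin_pi2_le_kink_energy R) _; rewrite lte_fin ltrDl.
have [N _ uN] := uE _ (open_ereal_lt' lt_e).
by exists N => // n Nn; apply/(energy_leP _ (Hu n))/ltW; exact: uN.
Qed.

Lemma eventually_momentum_near_pi2 u (p : nat -> R) : (forall n, H1loc (u n)) ->
  (forall e, 0 < e -> \forall n \near \oo, energy_le (u n) (kink_energy + e)) ->
  (forall n, momentum_is (re (u n)) (im (u n)) (re' (u n)) (im' (u n)) (p n)) ->
  (forall e : R, 0 < e -> exists N : nat, forall n, (N <= n)%N ->
     exists k : int, `|p n - pi / 2 - k%:~R * pi| < e) ->
  forall e, 0 < e -> \forall n \near \oo, momentum_near_pi2 (u n) e.
Proof.
move=> Hu uE up p_cvg e e0; have e2 : 0 < e / 2 by rewrite divr_gt0.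
have [N pN] := p_cvg _ e2.
near=> n; have [|k p_k] := pN n; first by near: n; exact: nbhs_infty_ge.
apply: momentum_is_near (Hu n) _ e0 (up n) p_k.
by near: n; exact: uE ltr01.
Unshelve. all: by end_near. Qed.

Lemma exists_centers u : (forall n, H1loc (u n)) ->
  (forall e, 0 < e -> \forall n \near \oo, energy_le (u n) (kink_energy + e)) ->
  (forall e, 0 < e -> \forall n \near \oo, momentum_near_pi2 (u n) e) ->
  exists c : nat -> R, forall d, 0 < d ->
    \forall n \near \oo, almost_kink (translate (c n) (u n)) d.
Proof.
move=> Hu uE up.
have [c c_inf] : {c : nat -> R & forall n,
    modsq (u n) (c n) < inf (range (modsq (u n))) + n.+1%:R^-1}.
  apply: (@choice _ _ (fun n c => modsq (u n) c < inf (range (modsq (u n))) + n.+1%:R^-1)) => n.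
  have n0 : 0 < n.+1%:R^-1 :> R by rewrite invr_gt0.
  have [|_ [c _ <-]] := @inf_adherent _ (range (modsq (u n))) _ n0; last by exists c.
  by split; [exists (modsq (u n) 0), 0|exists 0 => _ [t _ <-]; exact: modsq_ge0].
exists c => d d0; have d2 : 0 < d ^+ 2 / 50 by rewrite divr_gt0 ?exprn_gt0.
have d2' : 0 < d ^+ 2 / 2 by rewrite divr_gt0 ?exprn_gt0.
near=> n; split.
- exact: H1loc_translate.
- have inf_le : inf (range (modsq (u n))) <= 25 * (d ^+ 2 / 50).
    by apply: inf_modsq_le => //; [exact: ltW|near: n; exact: uE|near: n; exact: up].
  have n_le : n.+1%:R^-1 < d ^+ 2 / 2 by near: n; exact: (near_infty_natSinv_lt (PosNum d2')).
  rewrite modsq_translate add0r; apply: (le_trans (ltW (c_inf n))).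
  by have -> : d ^+ 2 = 25 * (d ^+ 2 / 50) + d ^+ 2 / 2 by [field]; rewrite lerD// ltW.
- by apply: energy_le_translate => //; near: n; exact: uE.
- by apply: momentum_near_pi2_translate => //; near: n; exact: up.
Unshelve. all: by end_near. Qed.

Lemma exists_subseq_kink_close u : (forall d, 0 < d -> \forall n \near \oo, almost_kink (u n) d) ->
  exists (s : nat -> nat) theta, {homo s : m n / (m < n)%N} /\
  forall L e, 0 < e -> \forall n \near \oo,
    forall x, - L <= x <= L -> kink_close (u (s n)) theta e x.
Proof.
move=> uK.
have [alpha alphaP] : {alpha : nat -> R & forall n,
    `|alpha n| <= pi /\ (0 < modsq (u n) 1 -> is_arg (u n) 1 (alpha n))}.
  apply: (@choice _ _ (fun n r => `|r| <= pi /\ (0 < modsq (u n) 1 -> is_arg (u n) 1 r))) => n.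
  have [/exists_arg[r r_pi ur]|_] := ltP 0 (modsq (u n) 1); first by exists r.
  by exists 0; rewrite normr0 pi_ge0.
have [s [theta [s_incr alpha_cvg]]] := subseq_cvg_of_bounded (fun n => proj1 (alphaP n)).
exists s, theta; split=> // L e e0; have e2 : 0 < e / 2 by rewrite divr_gt0.
have [c c0 near_c] := near_modsq_ge (@ltr01 R).
near (0 : R)^'+ => d.
have d0 : 0 < d by near: d; exact: nbhs_right_gt.
have cv : forall v, almost_kink v d -> forall y, 1 <= y -> c <= modsq v y.
  by near: d; exact: near_c.
have close : forall v, almost_kink v d -> forall alpha, is_arg v 1 alpha ->
    forall x, - L <= x <= L -> kink_close v alpha (e / 2) x.
  by near: d; exact: near_kink_close.
near=> n; have vK : almost_kink (u (s n)) d by near: n; exact: near_subseq (uK d d0).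
have v_arg : is_arg (u (s n)) 1 (alpha (s n)).
  by apply: (proj2 (alphaP (s n))); apply: lt_le_trans c0 (cv _ vK 1 (lexx 1)).
move=> x xL; apply: kink_close_le (kink_close_angle theta (close _ vK _ v_arg x xL)).
rewrite [leRHS]splitr lerD2r distrC; near: n.
exact: (proj1 (cvgrPdist_le _ _) alpha_cvg).
Unshelve. all: by end_near. Qed.

End minimizing_sequences.

Section upgraded_convergence.
Context {R : realType}.
Notation K := (@kink R).
Notation K' := (@kink' R).
Notation mu := (@lebesgue_measure R).
Variables (w : nat -> wave R) (theta : R).
Hypothesis Hw : forall n, H1loc (w n).
Hypothesis w_energy : forall e, 0 < e -> \forall n \near \oo, energy_le (w n) (kink_energy + e).
Hypothesis w_close : forall L e : R, 0 < e -> \forall n \near \oo,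
  forall x, - L <= x <= L -> kink_close (w n) theta e x.

Lemma sqrt_sqrD_le (x y : R) : Num.sqrt (x ^+ 2 + y ^+ 2) <= `|x| + `|y|.
Proof.
have xy0 : 0 <= `|x| + `|y| by rewrite addr_ge0.
rewrite -(ger0_norm xy0) -sqrtr_sqr ler_wsqrtr// sqrrD !real_normK ?num_real//.
by rewrite lerD2r lerDl mulrn_wge0// mulr_ge0.
Qed.

Lemma near_compact_kink_close (A : set R) e : compact A -> 0 < e ->
  \forall n \near \oo, forall x, A x ->
    Num.sqrt ((re (w n) x - cos theta * K x) ^+ 2 + (im (w n) x - sin theta * K x) ^+ 2) < e.
Proof.
move=> /compact_bounded[M [_ AM]] e0; have e3 : 0 < e / 3 by rewrite divr_gt0.
apply: filterS (w_close (`|M| + 1) e3) => n n_close x Ax.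
have [|re_le im_le] := n_close x.
  by rewrite -ler_norml; apply: AM => //; rewrite (le_lt_trans (ler_norm M))// ltrDl.
by apply: (le_lt_trans (sqrt_sqrD_le _ _)); lra.
Qed.

Lemma near_Int_gap_le e : 0 < e ->
  \forall n \near \oo, forall x y, x <= y -> Int x y (gap (w n) theta) <= e.
Proof.
move=> e0; have e6 : 0 < e / 6 by rewrite divr_gt0.
have e24 : 0 < e / 24 by rewrite divr_gt0.
have [tau [tau0 tau1 tau_e]] : exists tau : R, [/\ 0 < tau, tau <= 1 & tau <= e / 144].
  by exists (Num.min 1 (e / 144)); rewrite lt_min ltr01 !ge_min !lexx orbT divr_gt0.
near (pinfty_nbhs R) => L; have L0 : 0 <= L by near: L; exact: nbhs_pinfty_ge.
have K_L : 1 - K L <= e / 24 by near: L; exact: near_onem_kink_le.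
near=> n => x y xy.
have tau01 : 0 <= tau <= 1 by rewrite ltW.
have n_energy : energy_le (w n) (kink_energy + e / 6) by near: n; exact: w_energy.
have n_close : forall x, - L <= x <= L -> kink_close (w n) theta tau x.
  by near: n; exact: w_close.
by apply: (le_trans (Int_gap_le (Hw n) L0 tau01 n_energy n_close xy)); lra.
Unshelve. all: by end_near. Qed.

Lemma cvg0_integral_le_gap (f : nat -> R -> R) : (forall n, locint (f n)) ->
  (forall n t, 0 <= f n t <= 4 * gap (w n) theta t) ->
  (fun n => \int[mu]_t (f n t)%:E)%E @ \oo --> 0%E.
Proof.
move=> lf f_gap; apply: cvg0_integral => // [n t|e e0]; first by case/andP: (f_gap n t).
have e4 : 0 < e / 4 by rewrite divr_gt0.
apply: filterS (near_Int_gap_le e4) => n gap_n x y xy; have lg := locint_gap theta (Hw n).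
apply: (@le_trans _ _ (4 * Int x y (gap (w n) theta))); last by have := gap_n x y xy; lra.
rewrite -IntZ//; apply: le_Int => // [|t _]; first exact: locintZ.
by case/andP: (f_gap n t).
Qed.

Lemma cvg0_integral_potential_gap :
  (fun n => \int[mu]_t (((1 - modsq (w n) t) - (1 - K t ^+ 2)) ^+ 2)%:E)%E @ \oo --> 0%E.
Proof.
apply: cvg0_integral_le_gap => [n|n t].
  have [cn ck] := (continuous_modsq (Hw n), @continuous_kink R).
  by apply: continuous_locint; continuity.
rewrite sqr_ge0 /gap; have := sqr_ge0 (re' (w n) t - cos theta * K' t).
by have := sqr_ge0 (im' (w n) t - sin theta * K' t); lra.
Qed.

Lemma cvg0_integral_derivative_gap :
  (fun n => \int[mu]_t ((re' (w n) t - cos theta * K' t) ^+ 2 +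
                        (im' (w n) t - sin theta * K' t) ^+ 2)%:E)%E @ \oo --> 0%E.
Proof.
apply: cvg0_integral_le_gap => [n|n t]; last first.
  rewrite addr_ge0 ?sqr_ge0// /gap; have := sqr_ge0 ((1 - modsq (w n) t) - (1 - K t ^+ 2)).
  have := sqr_ge0 (re' (w n) t - cos theta * K' t).
  by have := sqr_ge0 (im' (w n) t - sin theta * K' t); lra.
have -> : (fun t => (re' (w n) t - cos theta * K' t) ^+ 2 + (im' (w n) t - sin theta * K' t) ^+ 2) =
    (fun t => 2 * gap (w n) theta t - 2^-1 * ((1 - modsq (w n) t) - (1 - K t ^+ 2)) ^+ 2).
  by apply/funext => t; rewrite /gap; field.
have [cn ck] := (continuous_modsq (Hw n), @continuous_kink R).
apply: locintB; first exact: locintZ (locint_gap theta (Hw n)).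
by apply: continuous_locint; continuity.
Qed.

End upgraded_convergence.

Theorem theorem4 (R : realType) (ua ub ua' ub' : nat -> R -> R) :
  (forall n, X1 (ua n) (ub n) (ua' n) (ub' n)) ->
  (exists p : nat -> R,
     (forall n, momentum_is (ua n) (ub n) (ua' n) (ub' n) (p n)) /\
     (forall eps : R, 0 < eps -> exists N : nat, forall n, (N <= n)%N ->
        exists k : int, `| p n - pi / 2 - k%:~R * pi | < eps)) ->
  (fun n => energy (ua n) (ub n) (ua' n) (ub' n)) @ \oo --> Emin_pi2 R ->
  exists (sigma : nat -> nat) (a : nat -> R) (theta : R),
    {homo sigma : m n / (m < n)%N >-> (m < n)%N} /\
    (forall K : set R, compact K -> forall eps : R, 0 < eps ->
       exists N : nat, forall n, (N <= n)%N -> forall x, K x ->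
         Num.sqrt ((ua (sigma n) (x + a (sigma n)) - cos theta * kink x) ^+ 2
                 + (ub (sigma n) (x + a (sigma n)) - sin theta * kink x) ^+ 2)
         < eps) /\
    ((fun n => (\int[(@lebesgue_measure R)]_x
        (((1 - (ua (sigma n) (x + a (sigma n)) ^+ 2
                + ub (sigma n) (x + a (sigma n)) ^+ 2))
          - (1 - kink x ^+ 2)) ^+ 2)%:E)%E) @ \oo --> 0%E) /\
    ((fun n => (\int[(@lebesgue_measure R)]_x
        ((ua' (sigma n) (x + a (sigma n)) - cos theta * derive1 (@kink R) x) ^+ 2
       + (ub' (sigma n) (x + a (sigma n)) - sin theta * derive1 (@kink R) x) ^+ 2)%:E)%E)
      @ \oo --> 0%E).
Proof.
move=> uX1 [p [u_p p_cvg]] uE.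
pose u n := Wave (ua n) (ub n) (ua' n) (ub' n).
have Hu n : H1loc (u n) by exact: X1_H1loc.
have u_energy := eventually_energy_le_kink Hu uE.
have u_momentum := eventually_momentum_near_pi2 Hu u_energy u_p p_cvg.
have [c uK] := exists_centers Hu u_energy u_momentum.
have [s [theta [s_incr w_close]]] := exists_subseq_kink_close uK.
pose w n := translate (c (s n)) (u (s n)).
have Hw n : H1loc (w n) by exact: H1loc_translate.
have w_energy (e : R) : 0 < e -> \forall n \near \oo, energy_le (w n) (kink_energy + e).
  move=> e0; apply: filterS (near_subseq s_incr (u_energy e e0)) => n.
  exact: energy_le_translate.
exists s, c, theta; split=> //; split; last split.
- move=> A cA eps eps0.
  by have [N _ AN] := near_compact_kink_close w_close cA eps0; exists N.
- exact: cvg0_integral_potential_gap Hw w_energy w_close.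
- under eq_fun do under eq_integral do rewrite derive1_kink.
  exact: cvg0_integral_derivative_gap Hw w_energy w_close.
Qed.
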